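(* Let $P$ be a Markov counting process with jump intensity $\ell$ (satisfying the standing assumptions below), and let $\Xi_\ell$ be its reciprocal characteristic. If $$\inf_{t\in[0,1],\,z\in\mathbb{N}}\Xi_\ell(t,z)\ge 0,$$ then for all $0\le s\le u\le 1$ and all $x\le y$ in $\mathbb{N}$, the function $[s,u]\ni t\mapsto E_{P^{xy}_{su}}(X_t)$ is convex. Conversely, if $$\sup_{t\in[0,1],\,z\in\mathbb{N}}\Xi_\ell(t,z)\le 0,$$ then for all $0\le s\le u\le 1$ and all $x\le y$ in $\mathbb{N}$, the function $[s,u]\ni t\mapsto E_{P^{xy}_{su}}(X_t)$ is concave.
   Context: $\Omega$ is the space of càdlàg step functions $\omega:[0,1]\to\mathbb{N}$ with finitely many jumps, all of amplitude $+1$, with no jump at $t=0$ or $t=1$; $X=(X_t)_{t\in[0,1]}$ is the canonical process. A Markov counting process with intensity $\ell:[0,1]\times\mathbb{N}\to\mathbb{R}_+$ is a probability $P$ on $\Omega$ under which $t\mapsto X_t-X_0-\int_0^t\ell(r,X_{r^-})\,dr$ is a local martingale. Standing assumptions: (i) for every $z$, $t\mapsto\ell(t,z)$ is continuously differentiable on $[0,1]$; (ii) $(t,z)\mapsto \ell(t,z+1)-\ell(t,z)$ is globally bounded above and below; (iii) $\ell(t,z)>0$ for all $t,z$; and the initial law of $P$ has full support on $\mathbb{N}$. For $s\le u$ and $x\le y$, the bridge is $P^{xy}_{su}(\cdot)=P(\cdot\mid X_s=x,X_u=y)$, and $E_{P^{xy}_{su}}$ denotes expectation under it. The reciprocal characteristic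 is $\Xi_\ell(t,z)=\partial_t\log\ell(t,z)+\ell(t,z+1)-\ell(t,z)$ if $\ell(t,z)\neq0$, and $\Xi_\ell(t,z)=0$ if $\ell(t,z)=0$. *)

(* Defs.v *)
From HB Require Import structures.
From mathcomp Require Import all_boot all_order all_algebra.
From mathcomp Require Import all_classical all_reals all_analysis.
Set Implicit Arguments. Unset Strict Implicit. Unset Printing Implicit Defensive.
Import Order.TTheory GRing.Theory Num.Theory.
Import numFieldNormedType.Exports.
Local Open Scope classical_set_scope.
Local Open Scope ring_scope.

(* The path space Omega: cadlag step functions [0,1] -> N with finitely
   many jumps, all of amplitude +1, no jump at 0 or 1.  Such a path is
   encoded (bijectively) by its initial value and the strictly increasing
   finite list of its jump times, all in the open interval (0,1).       *)
Definition good_jumps (R : realType) (js : seq R) : bool :=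
  path.sorted <%R js && all (fun r => (0 < r) && (r < 1)) js.

Record path_raw (R : realType) := PathRaw {
  path_x0 : nat;
  path_jumps : seq R;
  path_ok : good_jumps path_jumps }.

HB.instance Definition _ (R : realType) := gen_eqMixin (path_raw R).
HB.instance Definition _ (R : realType) := gen_choiceMixin (path_raw R).

Lemma good_jumps_nil (R : realType) : good_jumps (@nil R).
Proof. by []. Qed.

HB.instance Definition _ (R : realType) :=
  isPointed.Build (path_raw R) (PathRaw 0 (good_jumps_nil R)).

Definition Xproc (R : realType) (t : R) (w : path_raw R) : nat :=
  (path_x0 w + count (fun r : R => (r <= t)%R) (path_jumps w))%N.

Definition Xleft (R : realType) (t : R) (w : path_raw R) : nat :=
  (path_x0 w + count (fun r : R => (r < t)%R) (path_jumps w))%N.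

Definition coord_gen (R : realType) (D : set R) : set (set (path_raw R)) :=
  [set Xproc r @^-1` [set n] | r in D & n in [set: nat]].

Definition Omega (R : realType) :=
  g_sigma_algebraType (@coord_gen R `[0, 1]).

Definition filtr (R : realType) (t : R) : set (set (Omega R)) :=
  <<s @coord_gen R `[0, t] >>.

Definition is_stopping_time (R : realType) (T : Omega R -> \bar R) : Prop :=
  (forall w, (0 <= T w)%E) /\
  forall t, 0 <= t <= 1 -> filtr t [set w | (T w <= t%:E)%E].

Definition stopped (R : realType) (Y : R -> Omega R -> R)
  (T : Omega R -> \bar R) (t : R) (w : Omega R) : R :=
  Y (fine (Order.min t%:E (T w))) w.

Definition is_martingale (R : realType) (P : probability (Omega R) R)
  (Y : R -> Omega R -> R) : Prop :=
  (forall t, 0 <= t <= 1 ->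
     (forall B : set R, measurable B -> filtr t (Y t @^-1` B)) /\
     P.-integrable setT (fun w => (Y t w)%:E)) /\
  (forall s t, 0 <= s -> s <= t -> t <= 1 ->
     forall A, filtr s A ->
       (\int[P]_(w in A) (Y t w)%:E = \int[P]_(w in A) (Y s w)%:E)%E).

Definition is_local_martingale (R : realType) (P : probability (Omega R) R)
  (Y : R -> Omega R -> R) : Prop :=
  exists T : nat -> Omega R -> \bar R,
    (forall n, is_stopping_time (T n)) /\
    (forall n w, (T n w <= T n.+1 w)%E) /\
    {ae P, forall w, exists n, (1%:E <= T n w)%E} /\
    (forall n, is_martingale P (stopped Y (T n))).

Definition is_counting_process (R : realType) (l : R -> nat -> R)
  (P : probability (Omega R) R) : Prop :=
  is_local_martingale P
    (fun t w => (Xproc t w)%:R - (Xproc 0 w)%:R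
                - \int[lebesgue_measure]_(r in `[0, t]) l r (Xleft r w)).

Definition is_time_derivative (R : realType) (l dl : R -> nat -> R) : Prop :=
  forall z t, 0 <= t <= 1 ->
    (fun r => (l r z - l t z) / (r - t)) @ (within (`[0, 1] `\ t) (nbhs t))
      --> dl t z.

Definition standing_assumptions (R : realType) (l dl : R -> nat -> R) : Prop :=
  [/\ is_time_derivative l dl /\
        (forall z, {within `[0, 1], continuous (fun t => dl t z)}),
      (exists C : R, forall t z, 0 <= t <= 1 ->
          `|l t z.+1 - l t z| <= C)
    & (forall t z, 0 <= t <= 1 -> 0 < l t z)].

Definition Xi (R : realType) (l dl : R -> nat -> R) (t : R) (z : nat) : R :=
  if l t z != 0 then dl t z / l t z + (l t z.+1 - l t z) else 0.

Definition bridge_event (R : realType) (s u : R) (x y : nat) : set (Omega R) :=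
  [set w | Xproc s w = x /\ Xproc u w = y].

Definition bridge_mean (R : realType) (P : probability (Omega R) R)
  (s u : R) (x y : nat) (t : R) : R :=
  fine (\int[P]_(w in bridge_event s u x y) ((Xproc t w)%:R)%:E)
  / fine (P (bridge_event s u x y)).

(* Main.v *)
Require Import Defs.
From HB Require Import structures.
From mathcomp Require Import all_boot all_order all_algebra.
From mathcomp Require Import all_classical all_reals all_analysis.
From mathcomp Require Import measurable_realfun.
From mathcomp Require Import ring lra.
Import Order.TTheory GRing.Theory Num.Theory.
Import numFieldNormedType.Exports.
Local Open Scope classical_set_scope.
Local Open Scope ring_scope.

Set Implicit Arguments.
Unset Strict Implicit.
Unset Printing Implicit Defensive.

(** Fix [s <= u] and write [p t z = P (X_s = x, X_t = z)].  The martingale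
    property yields the Kolmogorov forward equation
    [p_z' = l_(z-1) p_(z-1) - l_z p_z]: on a window [[v, v+h]], a martingale
    increment and Fatou's lemma evaluate the mean increment of [X] up to
    [O(h^2)], and since the jumps have amplitude one, a grid argument shows that
    two jumps occur with probability [O(h^2)].  If [q] solves the backward
    equation [q_z' = l_z (q_z - q_(z+1))] with [q_z(u) = 1_(z = y)], then
    [sum_z p_z q_z] is constant in time for every law [p] solving the forward
    equation, whence [P (X_s = x, X_t = z, X_u = y) = p t z * q z t].  The
    unnormalised bridge mean is therefore [m = sum_z z p_z q_z]; summing by
    parts twice, [m' = sum_z l_z p_z q_(z+1)] and
    [m'' = sum_z l_z p_z q_(z+1) Xi_z], so the sign of [Xi] is that of [m'']. *)

(** Only a local martingale is given and no moment of [X] is assumed finite. The estimates are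
    therefore taken over events of the past on which the starting level is fixed, or exceeds a fixed
    level by an amount already known to be integrable. To remove the localisation, the martingale
    increment, stopped at [T n], is combined with a bound of the compensator into a nonnegative
    function whose mean does not depend on [n]; Fatou then yields the estimate and, for the upper
    bound, integrability of the increment.

    The Markov property is replaced by a duality: the forward equation is proved for
    [P (A, X_t = z)] with an arbitrary event [A] of the past, and pairing it with the backward
    solution gives the factorisation of the three-time law. Since jumps only go up, [q] vanishes
    above [y]; the backward system is triangular and all sums stop at [y], so no summability over
    levels is ever at stake. *)

(** * Monotonicity and unit jumps of the paths *)

Section Paths.
Variable R : realType.
Implicit Types (w : path_raw R) (r s t v : R) (js : seq R) (n z : nat).

Lemma Xproc_le s t w : s <= t -> (Xproc s w <= Xproc t w)%N.
Proof.
move=> st; rewrite /Xproc leq_add2l; apply: sub_count => r /= rs.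
exact: le_trans st.
Qed.

Lemma Xleft_le_Xproc r t w : r <= t -> (Xleft r w <= Xproc t w)%N.
Proof.
move=> rt; rewrite /Xleft /Xproc leq_add2l; apply: sub_count => q /= qr.
by apply: ltW; exact: lt_le_trans rt.
Qed.

Lemma Xproc_le_Xleft v r w : v < r -> (Xproc v w <= Xleft r w)%N.
Proof.
move=> vr; rewrite /Xleft /Xproc leq_add2l; apply: sub_count => q /= qv.
exact: le_lt_trans vr.
Qed.

Lemma ltn_count_le_sorted js t n : path.sorted <%R js ->
  (n < count (fun r => (r <= t)%R) js)%N = (n < size js)%N && (nth 0 js n <= t).
Proof.
elim: js n => [|a js IH] n //= pjs.
have sjs := path_sorted pjs.
case: (leP a t) => [at_|ta] /=; first by case: n => [|n] /=; rewrite ?at_ ?add1n ?ltnS ?IH.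
have -> : count (fun r => (r <= t)%R) js = 0%N.
  apply/eqP; rewrite -leqn0 leqNgt -has_count; apply/hasPn => q qjs.
  have := order_path_min lt_trans pjs; move/allP/(_ _ qjs) => aq.
  by rewrite -ltNge; exact: lt_trans aq.
apply/esym/negP => /andP[nsz nt].
suff : a <= nth 0 (a :: js) n by move/le_trans => /(_ _ nt); rewrite leNgt ta.
case: n nsz {nt} => [|n] //= nsz; apply/ltW.
by have /allP := order_path_min lt_trans pjs; apply; rewrite mem_nth.
Qed.

(* All jumps have amplitude one: a path that climbs two levels stays on the
   intermediate level for some time. *)
Lemma Xproc_plateau v v' w z : Xproc v w = z -> (z.+2 <= Xproc v' w)%N ->
  exists a b, [/\ v <= a, a < b, b <= v' &
    forall r, a <= r -> r < b -> Xproc r w = z.+1].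
Proof.
case: w => x0 js ok; rewrite /Xproc /= => vz v'z.
have /andP[sjs _] := ok.
have ltc t n := ltn_count_le_sorted t n sjs.
pose i := count (fun r => (r <= v)%R) js.
have iz : (x0 + i = z)%N by [].
have : (i.+1 < count (fun r => (r <= v')%R) js)%N.
  by move: v'z; rewrite -iz -2!addnS leq_add2l.
rewrite ltc => /andP[isz iv'].
have isz' : (i < size js)%N by exact: ltn_trans isz.
exists (nth 0 js i), (nth 0 js i.+1); split => //.
- by apply: ltW; rewrite ltNge; apply/negP => h; have := ltc v i; rewrite ltnn isz' h.
- by have /(sorted_ltn_nth lt_trans 0) := sjs; apply.
move=> r ar rb; rewrite -iz -addnS; congr addn.
apply/eqP; rewrite eqn_leq; apply/andP; split; last by rewrite ltc isz' ar.
by rewrite leqNgt ltc isz /= -ltNge.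
Qed.

End Paths.

(** * The compensator along a fixed path *)

Section Compensator.
Variables (R : realType) (l : R -> nat -> R) (C : R).
Hypothesis l_cont : forall z, {within `[0, 1], continuous (l^~ z)}.
Hypothesis l_lip : forall t z, 0 <= t <= 1 -> `|l t z.+1 - l t z| <= C.
Implicit Types (w : path_raw R).

Local Notation mu := (@lebesgue_measure R).

Lemma measurable_Xleft_level w n : measurable [set r : R | Xleft r w = n].
Proof.
(* These sets are intervals, because [Xleft] is nondecreasing in time. *)
have up k : measurable [set r : R | (k <= Xleft r w)%N].
  apply: is_interval_measurable => a b /= ka _ r /andP[ar _].
  apply: (leq_trans ka); rewrite /Xleft leq_add2l; apply: sub_count => q /= qa.
  exact: lt_le_trans ar.
have -> : [set r : R | Xleft r w = n] =
    [set r | (n <= Xleft r w)%N] `\` [set r | (n.+1 <= Xleft r w)%N].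
  apply/seteqP; split=> r /=; first by move=> ->; rewrite leqnn ltnn.
  by move=> [nr /negP]; rewrite -leqNgt => rn; apply/eqP; rewrite eqn_leq rn.
exact: measurableD.
Qed.

(** A path visits only levels up to [Xproc 1 w], so on [0,1] the integrand is a finite sum of
    continuous functions cut to measurable level sets. *)
Lemma integrable_intensity w :
  mu.-integrable `[0, 1] (EFin \o (fun r => l r (Xleft r w))).
Proof.
pose f k : R -> \bar R := (EFin \o l^~ k) \_ [set r | Xleft r w = k].
have fint k : mu.-integrable `[0, 1] (f k).
  apply/integrable_restrict => //; first exact: measurable_Xleft_level.
  apply: (@integrableS _ _ _ mu `[0, 1]) => //.
  - by apply: measurableI => //; exact: measurable_Xleft_level.
  - by apply: continuous_compact_integrable => //; exact: segment_compact.
have fsum := @integrable_sum _ _ _ mu `[0, 1] _ _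
  (index_iota 0 (Xproc 1 w).+1) predT f (fun i _ => fint i).
apply: eq_integrable (fsum (measurable_itv _)) => //= r.
rewrite inE /= in_itv /= => /andP[_ r1].
rewrite (bigD1_seq (Xleft r w)) ?iota_uniq //=; last first.
  by rewrite mem_index_iota /= ltnS; exact: Xleft_le_Xproc.
rewrite big1 ?addr0.
  by rewrite /f patchE mem_set.
by move=> k kr; rewrite /f patchE memNset //= => h; rewrite h eqxx in kr.
Qed.

Lemma intensity_lipschitz t z k : 0 <= t <= 1 ->
  `|l t (z + k)%N - l t z| <= C * k%:R.
Proof.
move=> t01; elim: k => [|k IH]; first by rewrite addn0 subrr normr0 mulr0.
rewrite addnS -natr1 mulrDr mulr1.
have -> : l t (z + k).+1 - l t z =
  (l t (z + k)%N - l t z) + (l t (z + k).+1 - l t (z + k)%N) by ring.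
by apply: (le_trans (ler_normD _ _)); apply: lerD => //; exact: l_lip.
Qed.

Definition compensator t w : R := \int[mu]_(r in `[0, t]) l r (Xleft r w).

(** During the window the level lies between [z] and [X_t], so the intensity differs from [l r z] by
    at most [C (X_t - z)]. Expressing the error through the end value lets it be absorbed into the
    increment of [X] later. *)
Lemma compensator_increment v t w z a b : 0 <= v -> v <= t -> t <= 1 ->
  (z <= Xproc v w)%N ->
  (forall r, v <= r <= t -> a <= l r z <= b) ->
  (a - C * (Xproc t w - z)%:R) * (t - v) <= compensator t w - compensator v w
  <= (b + C * (Xproc t w - z)%:R) * (t - v).
Proof.
move=> v0 vt t1 zv lab.
have C0 : 0 <= C by apply: le_trans (normr_ge0 _) (@l_lip 0 0 _); rewrite lexx ler01.
have int01 := integrable_intensity w.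
have intS (i : interval R) : [set` i] `<=` `[0, 1] ->
    mu.-integrable [set` i] (EFin \o (fun r => l r (Xleft r w))).
  move=> i01; exact: (@integrableS _ _ _ mu `[0, 1] [set` i] _
    (measurable_itv _) (measurable_itv _) i01 int01).
have -> : compensator t w - compensator v w =
    \int[mu]_(r in `]v, t]) l r (Xleft r w).
  apply: Rintegral_itvB.
  - by apply: intS => r /=; rewrite !in_itv /= => /andP[-> /le_trans]; apply.
  - by rewrite bnd_simp.
  - by rewrite bnd_simp.
have cst c : \int[mu]_(r in `]v, t]) c = c * (t - v).
  rewrite Rintegral_cst //= lebesgue_measure_itv /= lte_fin.
  case: ltP => [//|tv] /=; have -> : t = v by apply/eqP; rewrite eq_le tv vt.
  by rewrite subrr mulr0.
have icst c : mu.-integrable `]v, t] (EFin \o (fun=> c : R)).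
  apply: measurable_bounded_integrable => //.
    by rewrite /= lebesgue_measure_itv /=; case: ifP => // _; rewrite -EFinB ltry.
  exact: bounded_cst.
have ilS : mu.-integrable `]v, t] (EFin \o (fun r => l r (Xleft r w))).
  apply: intS => r /=; rewrite !in_itv /= => /andP[/ltW vr rt].
  by rewrite (le_trans v0 vr) (le_trans rt t1).
have bd r : `]v, t]%classic r ->
    a - C * (Xproc t w - z)%:R <= l r (Xleft r w) <= b + C * (Xproc t w - z)%:R.
  rewrite /= in_itv /= => /andP[vr rt].
  have r01 : 0 <= r <= 1 by rewrite (le_trans v0 (ltW vr)) (le_trans rt t1).
  have zr : (z <= Xleft r w)%N by apply: (leq_trans zv); exact: Xproc_le_Xleft.
  have rt' : (Xleft r w <= Xproc t w)%N by exact: Xleft_le_Xproc.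
  have := intensity_lipschitz z (Xleft r w - z) r01; rewrite subnKC //.
  have /andP[] : a <= l r z <= b by apply: lab; rewrite (ltW vr) rt.
  have : C * (Xleft r w - z)%:R <= C * (Xproc t w - z)%:R.
    by apply: ler_wpM2l => //; rewrite ler_nat leq_sub2r.
  rewrite ler_norml; move: (C * _) (C * _) (l r _) (l r _) => c1 c2 l1 l2.
  by move=> h1 h2 h3 /andP[h4 h5]; apply/andP; split; lra.
apply/andP; split; rewrite -cst; apply: le_Rintegral => // r /bd /andP[] //.
Qed.

End Compensator.

(** * Fatou's lemma with eventual domination *)

Section Fatou.
Context d (T : measurableType d) (R : realType).
Variables (mu : {finite_measure set T -> \bar R}) (B : set T).
Hypothesis mB : measurable B.

(** Domination is asked only eventually, from a rank depending on the point: this fits both stopping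
    times that finally exceed 1 and grids that finally resolve the jumps of a path. *)
Lemma fatou_Rintegral_le (f : nat -> T -> R) (g : T -> R) (c : R) :
  (forall n, mu.-integrable B (EFin \o f n)) ->
  (forall n x, B x -> 0 <= f n x) ->
  (forall n, \int[mu]_(x in B) f n x <= c) ->
  measurable_fun B g -> (forall x, B x -> 0 <= g x) ->
  {ae mu, forall x, B x -> exists n0, forall n, (n0 <= n)%N -> g x <= f n x} ->
  mu.-integrable B (EFin \o g) /\ \int[mu]_(x in B) g x <= c.
Proof.
move=> fi f0 fc mg g0 gf.
have mf n : measurable_fun B (EFin \o f n) by exact: measurable_int (fi n).
have mEg : measurable_fun B (EFin \o g) by exact/measurable_EFinP.
have key : (\int[mu]_(x in B) (g x)%:E <= c%:E)%E.
  apply: (@le_trans _ _ (\int[mu]_(x in B) limn_einf (fun n => (f n x)%:E))%E).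
    apply: ae_ge0_le_integral => //.
    - by move=> x Bx; rewrite limn_einf_lim; apply: lime_ge;
        [exact: is_cvg_einfs | near=> n; apply: le_ereal_inf_tmp => _ [m _ <-];
         rewrite lee_fin f0].
    - apply: (eq_measurable_fun (fun x => - limn_esup (fun n => - (f n x)%:E))%E).
        by move=> x _; rewrite -limn_einfN; congr limn_einf; apply/funext => n /=;
          rewrite opprK.
      apply: measurableT_comp => //; apply: measurable_fun_limn_esup => n.
      by apply: measurableT_comp => //; exact: mf.
    - apply: filterS gf => x gfx Bx; have [n0 n0f] := gfx Bx.
      rewrite limn_einf_lim; apply: lime_ge; first exact: is_cvg_einfs.
      near=> n; apply: le_ereal_inf_tmp => _ [m nm <-]; rewrite lee_fin.
      apply: n0f; apply: leq_trans nm; near: n; exact: nbhs_infty_ge.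
  apply: (le_trans (fatou mu mB mf _)) => [n x Bx|]; first by rewrite lee_fin f0.
  rewrite limn_einf_lim; apply: lime_le; first exact: is_cvg_einfs.
  near=> n; apply: (@le_trans _ _ (\int[mu]_(x in B) (f n x)%:E)%E).
    by apply: ereal_inf_lbound; exists n => //=.
  rewrite -(@fineK _ (\int[mu]_(x in B) (f n x)%:E)%E) ?lee_fin //; first exact: fc.
  exact: (integrable_fin_num mB (fi n)).
have ig : mu.-integrable B (EFin \o g).
  apply/integrableP; split => //.
  rewrite (eq_integral (fun x => (g x)%:E)); last first.
    by move=> x /set_mem Bx /=; rewrite ger0_norm // g0.
  by apply: (le_lt_trans key); rewrite ltry.
split => //; rewrite -lee_fin /Rintegral fineK //.
exact: (integrable_fin_num mB ig).
Unshelve. all: by end_near. Qed.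

End Fatou.

(** * Events of the canonical filtration *)

Section Filtration.
Variable R : realType.
Implicit Types (s t r : R) (A : set (Omega R)).

Lemma filtr_le s t A : s <= t -> filtr s A -> filtr t A.
Proof.
move=> st; apply: sub_smallest2r; first exact: smallest_sigma_algebra.
move=> _ [r rs [n _ <-]]; exists r; last by exists n.
by move: rs; rewrite /= !in_itv /= => /andP[-> /le_trans]; apply.
Qed.

Lemma filtr_measurable t A : t <= 1 -> filtr t A -> measurable A.
Proof. exact: filtr_le. Qed.

Lemma filtrI t A A' : filtr t A -> filtr t A' -> filtr t (A `&` A').
Proof.
exact: (@measurableI _ (g_sigma_algebraType (@coord_gen R `[0, t])) A A').
Qed.

Lemma filtr_Xproc r t (D : set nat) : 0 <= r -> r <= t ->
  filtr t [set w | D (Xproc r w)].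
Proof.
move=> r0 rt.
have -> : [set w : Omega R | D (Xproc r w)] =
    \bigcup_(n in D) [set w | Xproc r w = n].
  by apply/seteqP; split => [w Dw|w [n Dn] /= ->] //; exists (Xproc r w).
apply: (@bigcup_measurable _ (g_sigma_algebraType (@coord_gen R `[0, t]))).
move=> n _; apply: sub_sigma_algebra; exists r; last by exists n.
by rewrite /= in_itv /= r0.
Qed.

Lemma measurable_Xproc r (D : set nat) : 0 <= r <= 1 ->
  measurable [set w : Omega R | D (Xproc r w)].
Proof. by case/andP=> r0 r1; apply: filtr_measurable (filtr_Xproc _ r0 r1). Qed.

Lemma measurable_fun_Xproc r (g : nat -> R) B : 0 <= r <= 1 -> measurable B ->
  measurable_fun B (fun w : Omega R => g (Xproc r w)).
Proof.
move=> r01 mB _ Y _; apply: measurableI => //.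
exact: (@measurable_Xproc r (fun n => Y (g n))).
Qed.

End Filtration.

(** * Times frozen by a stopping time *)

Section StoppedTime.
Variable R : realType.

(** Either the process was stopped before the window and does not move, or it runs from [v] to a
    time of the window. Bounds for stopped increments thus reduce to unstopped ones on a shorter
    window. *)
Lemma stopped_time_cases (v v' : R) (T : \bar R) : v <= v' -> (0 <= T)%E ->
  let tau t := fine (Order.min t%:E T) in
  tau v = tau v' \/ (tau v = v /\ v <= tau v' <= v').
Proof.
move=> vv' T0 /=; case: T T0 => [r| |] // r0; rewrite !minEle ?lee_fin.
- have [vr|rv] := leP v r.
    right; split => //; case: (leP v' r) => //= [v'r|/ltW rv']; first by rewrite vv' lexx.
    by rewrite vr rv'.
  by left; case: (leP v' r) => //= v'r; have := lt_le_trans rv (le_trans vv' v'r);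
    rewrite ltxx.
- by right; rewrite !leey /=; split => //; rewrite vv' lexx.
Qed.

Lemma stopped_time_id (t : R) (T : \bar R) : t <= 1 -> (1%:E <= T)%E ->
  fine (Order.min t%:E T) = t.
Proof.
by move=> t1 T1; rewrite minEle (le_trans _ T1) //= lee_fin.
Qed.

End StoppedTime.

(** * Mean increments of [X] over a short window *)

Section MeanIncrements.
Variables (R : realType) (l : R -> nat -> R) (C : R) (P : probability (Omega R) R).
Hypothesis l_cont : forall z, {within `[0, 1], continuous (l^~ z)}.
Hypothesis l_lip : forall t z, 0 <= t <= 1 -> `|l t z.+1 - l t z| <= C.
Hypothesis P_counting : is_counting_process l P.

Let M t (w : Omega R) : R := (Xproc t w)%:R - (Xproc 0 w)%:R - compensator l t w.

Definition increment (v v' : R) (w : Omega R) : R := (Xproc v' w)%:R - (Xproc v w)%:R.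

Lemma increment_ge0 v v' w : v <= v' -> 0 <= increment v v' w.
Proof. by move=> vv'; rewrite subr_ge0 ler_nat; exact: Xproc_le. Qed.

Lemma measurable_increment v v' B : 0 <= v <= 1 -> 0 <= v' <= 1 ->
  measurable B -> measurable_fun B (increment v v').
Proof.
by move=> v01 v'01 mB; apply: measurable_funB;
  [exact: (measurable_fun_Xproc (fun n => n%:R))
  |exact: (measurable_fun_Xproc (fun n => n%:R))].
Qed.

Let C0 : 0 <= C.
Proof. by apply: le_trans (normr_ge0 _) (@l_lip 0 0 _); rewrite lexx ler01. Qed.

Section Window.
Variables (v v' : R) (B : set (Omega R)) (z : nat) (a b : R).
Hypotheses (v0 : 0 <= v) (vv' : v <= v') (v'1 : v' <= 1).
Hypothesis FB : filtr v B.
Hypothesis a0 : 0 <= a.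
Hypothesis lab : forall r, v <= r <= v' -> a <= l r z <= b.

Let v01 : 0 <= v <= 1. Proof. by rewrite v0 (le_trans vv' v'1). Qed.
Let v'01 : 0 <= v' <= 1. Proof. by rewrite v'1 (le_trans v0 vv'). Qed.
Let mB : measurable B.
Proof. by apply: filtr_measurable FB; case/andP: v01. Qed.

Let b0 : 0 <= b.
Proof.
have /andP[al lb] : a <= l v z <= b by apply: lab; rewrite lexx vv'.
exact: le_trans a0 (le_trans al lb).
Qed.

Let N (T : Omega R -> \bar R) w := stopped M T v' w - stopped M T v w.

(** The upper bound of the compensator, with [X_t - z] split at [X_v]: the part [X_t - X_v] is
    absorbed on the left, and what remains depends only on time [v]. *)
Let N_ge T w : (0 <= T w)%E -> (z <= Xproc v w)%N -> (v' - v) * C <= 1 ->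
  0 <= N T w + (v' - v) * (b + C * ((Xproc v w)%:R - z%:R)) /\
  ((1%:E <= T w)%E -> (1 - (v' - v) * C) * increment v v' w <=
    N T w + (v' - v) * (b + C * ((Xproc v w)%:R - z%:R))).
Proof.
move=> T0 zv hC.
have dz0 : 0 <= (Xproc v w)%:R - z%:R :> R by rewrite subr_ge0 ler_nat.
have base t : v <= t <= v' -> (1 - (v' - v) * C) * increment v t w <=
    M t w - M v w + (v' - v) * (b + C * ((Xproc v w)%:R - z%:R)).
  case/andP=> vt tv'.
  have lab' r : v <= r <= t -> a <= l r z <= b.
    by case/andP=> vr rt; apply: lab; rewrite vr (le_trans rt tv').
  have /andP[_] := compensator_increment l_cont l_lip v0 vt
    (le_trans tv' v'1) zv lab'.
  have ztn : (z <= Xproc t w)%N by apply: (leq_trans zv); exact: Xproc_le.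
  rewrite natrB // /M /increment.
  have : 0 <= (Xproc t w)%:R - (Xproc v w)%:R :> R.
    by rewrite subr_ge0 ler_nat; exact: Xproc_le.
  move: dz0 b0 C0 vt tv' vv'.
  move: (Xproc t w)%:R (Xproc v w)%:R (Xproc 0 w)%:R (z%:R)
    (compensator l t w) (compensator l v w) => x y x0 k c c'.
  move=> h1 h2 h3 h4 h5 h6 h7 h8.
  have : (b + C * (x - k)) * (t - v) <= (b + C * (x - k)) * (v' - v).
    apply: ler_wpM2l; last by lra.
    apply: addr_ge0 => //; apply: mulr_ge0 => //; lra.
  by lra.
split; last first.
  move=> T1; rewrite /N /stopped !stopped_time_id //; last by case/andP: v01.
  by apply: base; rewrite vv' lexx.
rewrite /N /stopped; have [e|[-> tau]] := stopped_time_cases vv' T0.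
  rewrite e subrr add0r mulr_ge0 ?subr_ge0 //; apply: addr_ge0 => //.
  exact: mulr_ge0.
apply: le_trans (base _ tau); apply: mulr_ge0; first by rewrite subr_ge0.
by apply: increment_ge0; case/andP: tau.
Qed.

(** The mirror of [N_ge], from the lower bound of the compensator: here the nonnegative function for
    Fatou is a multiple of the increment minus [N]. *)
Let N_le T w : (0 <= T w)%E -> Xproc v w = z ->
  N T w <= (1 + (v' - v) * C) * increment v v' w /\
  ((1%:E <= T w)%E ->
    a * (v' - v) <= (1 + (v' - v) * C) * increment v v' w - N T w).
Proof.
move=> T0 zv.
have h0 : 0 <= v' - v by rewrite subr_ge0.
have base t : v <= t <= v' -> M t w - M v w + a * (t - v) <=
    (1 + (v' - v) * C) * increment v t w.
  case/andP=> vt tv'.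
  have lab' r : v <= r <= t -> a <= l r z <= b.
    by case/andP=> vr rt; apply: lab; rewrite vr (le_trans rt tv').
  have zv' : (z <= Xproc v w)%N by rewrite zv.
  have /andP[+ _] := compensator_increment l_cont l_lip v0 vt
    (le_trans tv' v'1) zv' lab'.
  have := increment_ge0 w vt.
  rewrite natrB; last by rewrite -zv; exact: Xproc_le.
  rewrite /M /increment -zv; move: C0 vt tv' vv'.
  move: (Xproc t w)%:R (Xproc v w)%:R (Xproc 0 w)%:R
    (compensator l t w) (compensator l v w) => x y x0 c c'.
  move=> h1 h2 h3 h4 h5 h6.
  have : (C * (x - y)) * (t - v) <= (C * (x - y)) * (v' - v).
    by apply: ler_wpM2l; [exact: mulr_ge0|lra].
  by lra.
split; last first.
  move=> T1; rewrite /N /stopped !stopped_time_id //; last by case/andP: v01.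
  have := base v'; rewrite vv' lexx => /(_ isT).
  by move: (M v' w) (M v w) (increment v v' w) => m m' i; lra.
have c0 : 0 <= 1 + (v' - v) * C by apply: addr_ge0 => //; exact: mulr_ge0.
rewrite /N /stopped; have [e|[-> tau]] := stopped_time_cases vv' T0.
  by rewrite e subrr; apply: mulr_ge0 => //; exact: increment_ge0.
case/andP: (tau) => vt tv'.
apply: (@le_trans _ _ ((1 + (v' - v) * C) *
    increment v (fine (Order.min v'%:E (T w))) w)).
  apply: le_trans (base _ tau); rewrite lerDl; apply: mulr_ge0 => //.
  by rewrite subr_ge0.
apply: ler_wpM2l => //; rewrite /increment lerD2r ler_nat; exact: Xproc_le.
Qed.

(** As [B] is an event of time [v], the stopped martingale has mean increment zero over it.
    Monotonicity of the localising sequence turns one good index into all large ones. *)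
Let N_mart : exists T : nat -> Omega R -> \bar R,
  [/\ forall n w, (0 <= T n w)%E,
      {ae P, forall w, exists n0, forall n, (n0 <= n)%N -> (1%:E <= T n w)%E},
      forall n, P.-integrable B (EFin \o N (T n)) &
      forall n, \int[P]_(w in B) N (T n) w = 0].
Proof.
have [T [Tst [Tmono [Tae Tmart]]]] := P_counting.
have int n t : 0 <= t <= 1 -> P.-integrable B (EFin \o stopped M (T n) t).
  move=> t01; have [/(_ t t01) [_ it] _] := Tmart n.
  exact: (@integrableS _ _ _ P setT B _ measurableT mB (@subsetT _ B) it).
exists T; split.
- by move=> n w; have [T0 _] := Tst n.
- apply: filterS Tae => w [n0 n0T]; exists n0 => n /subnK <-.
  elim: (n - n0)%N => [|k IH]; first by rewrite add0n.
  by rewrite addSn; exact: le_trans IH (Tmono _ _).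
- move=> n; apply: (@integrableB _ _ _ P B mB (EFin \o stopped M (T n) v')
    (EFin \o stopped M (T n) v)); exact: int.
- move=> n; rewrite RintegralB //; [|exact: int|exact: int].
  have [_ /(_ v v' v0 vv' v'1 B FB)] := Tmart n.
  by rewrite /Rintegral => ->; rewrite subrr.
Qed.

(** Fatou applied to [N (T n) + K], of mean [K] for every [n]. The smallness of the window keeps
    [1 - (v' - v) * C] away from 0, so integrability passes to the increment itself. *)
Lemma mean_increment_le : (forall w, B w -> (z <= Xproc v w)%N) ->
  P.-integrable B (EFin \o (fun w => (Xproc v w)%:R - z%:R : R)) ->
  (v' - v) * C <= 1 / 2 ->
  P.-integrable B (EFin \o increment v v') /\
  (1 - (v' - v) * C) * (\int[P]_(w in B) increment v v' w) <=
  (v' - v) * (b * fine (P B) + C * \int[P]_(w in B) ((Xproc v w)%:R - z%:R)).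
Proof.
move=> zB iX hC.
have hC1 : (v' - v) * C <= 1 by move: ((v' - v) * C) hC => c; lra.
have [T [T0 Tae iN N0]] := N_mart.
pose K := fun w => (v' - v) * (b + C * ((Xproc v w)%:R - z%:R)).
have iK' : P.-integrable B (EFin \o (fun w => C * ((Xproc v w)%:R - z%:R))).
  exact: (integrableZl mB C iX).
have ib : P.-integrable B (EFin \o cst b).
  exact: finite_measure_integrable_cst.
have iK'' : P.-integrable B (EFin \o (fun w => b + C * ((Xproc v w)%:R - z%:R))).
  exact: (integrableD mB ib iK').
have iK : P.-integrable B (EFin \o K) by exact: (integrableZl mB _ iK'').
have KE : \int[P]_(w in B) K w =
    (v' - v) * (b * fine (P B) + C * \int[P]_(w in B) ((Xproc v w)%:R - z%:R)).
  rewrite RintegralZl // RintegralD // Rintegral_cst // RintegralZl //.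
have iNK n : P.-integrable B (EFin \o (fun w => N (T n) w + K w)).
  exact: (integrableD mB (iN n) iK).
have [] := @fatou_Rintegral_le _ _ _ P B mB (fun n w => N (T n) w + K w)
  (fun w => (1 - (v' - v) * C) * increment v v' w) (\int[P]_(w in B) K w) iNK.
- by move=> n w Bw; have [] := N_ge (T0 n w) (zB w Bw) hC1.
- by move=> n; rewrite RintegralD // N0 add0r.
- by apply: measurable_funM => //; exact: measurable_increment.
- move=> w Bw; apply: mulr_ge0; first by rewrite subr_ge0.
  exact: increment_ge0.
- apply: filterS Tae => w [n0 n0T] Bw; exists n0 => n nn0.
  by have [_] := N_ge (T0 n w) (zB w Bw) hC1; apply; exact: n0T.
move=> ig gle.
have c0 : 1 - (v' - v) * C != 0.
  by apply/eqP; move: ((v' - v) * C) hC => c; lra.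
have ii : P.-integrable B (EFin \o increment v v').
  have := integrableZl mB (1 - (v' - v) * C)^-1 ig.
  apply: eq_integrable => // w _ /=.
  by rewrite -EFinM mulrA mulVf // mul1r.
by split => //; move: gle; rewrite RintegralZl // KE.
Qed.

(** Fatou applied to [K - N (T n)]; the integrability of the increment, supplied by the upper bound,
    makes its mean finite and independent of [n]. *)
Lemma mean_increment_ge : (forall w, B w -> Xproc v w = z) ->
  P.-integrable B (EFin \o increment v v') ->
  a * (v' - v) * fine (P B) <=
  (1 + (v' - v) * C) * (\int[P]_(w in B) increment v v' w).
Proof.
move=> zB ii.
have [T [T0 Tae iN N0]] := N_mart.
pose K := fun w => (1 + (v' - v) * C) * increment v v' w.
have iK : P.-integrable B (EFin \o K) by exact: (integrableZl mB _ ii).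
have iNK n : P.-integrable B (EFin \o (fun w => K w - N (T n) w)).
  exact: (integrableB mB iK (iN n)).
have [] := @fatou_Rintegral_le _ _ _ P B mB (fun n w => K w - N (T n) w)
  (fun w => a * (v' - v)) (\int[P]_(w in B) K w) iNK.
- by move=> n w Bw; have [] := N_le (T0 n w) (zB w Bw); rewrite -subr_ge0.
- by move=> n; rewrite RintegralB // N0 subr0.
- exact: measurable_cst.
- by move=> w Bw; apply: mulr_ge0 => //; rewrite subr_ge0.
- apply: filterS Tae => w [n0 n0T] Bw; exists n0 => n nn0.
  by have [_] := N_le (T0 n w) (zB w Bw); apply; exact: n0T.
by move=> _; rewrite Rintegral_cst // RintegralZl.
Qed.

End Window.
End MeanIncrements.

(** * Two jumps in a short window *)

Section DoubleJumps.
Variables (R : realType) (l : R -> nat -> R) (C : R) (P : probability (Omega R) R).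
Hypothesis l_cont : forall z, {within `[0, 1], continuous (l^~ z)}.
Hypothesis l_lip : forall t z, 0 <= t <= 1 -> `|l t z.+1 - l t z| <= C.
Hypothesis P_counting : is_counting_process l P.

Lemma Rintegral_sum d (T : measurableType d) (mu : {measure set T -> \bar R})
    (B : set T) (f : nat -> T -> R) n : measurable B ->
  (forall k, mu.-integrable B (EFin \o f k)) ->
  mu.-integrable B (EFin \o (fun x => \sum_(k < n) f k x)) /\
  \int[mu]_(x in B) (\sum_(k < n) f k x) = \sum_(k < n) \int[mu]_(x in B) f k x.
Proof.
move=> mB fi; elim: n => [|n [ii IH]].
  rewrite big_ord0; have e : (fun x => \sum_(k < 0) f k x) = cst 0.
    by apply/funext => x; rewrite big_ord0.
  by split; rewrite e; [exact: integrable0 | rewrite Rintegral_cst // mul0r].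
have e : (fun x => \sum_(k < n.+1) f k x) =
    (fun x => \sum_(k < n) f k x + f n x).
  by apply/funext => x; rewrite big_ord_recr.
rewrite e big_ord_recr /= -IH; split; last by rewrite RintegralD.
exact: (integrableD mB ii (fi n)).
Qed.

(** By monotonicity every term from index [k] on is counted, and these terms telescope. *)
Lemma sum_increments_above (x : nat -> nat) z k n :
  (forall i, (x i <= x i.+1)%N) -> (z < x k)%N -> (k <= n)%N ->
  (x n)%:R - (x k)%:R <=
  \sum_(i < n) (if (z < x i)%N then (x i.+1)%:R - (x i)%:R else 0) :> R.
Proof.
move=> xmon zk /subnK <-.
have xk i : (x k <= x (i + k))%N.
  by elim: i => // i IH; rewrite addSn; exact: leq_trans IH (xmon _).
elim: (n - k)%N => [|m IH].
  rewrite add0n subrr; apply: sumr_ge0 => i _.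
  by case: ifP => // _; rewrite subr_ge0 ler_nat.
rewrite addSn big_ord_recr /= (leq_trans zk (xk m)).
by move: IH; move: (\sum_(_ < _) _) => S; move: (x _)%:R (x _)%:R (x _)%:R => *; lra.
Qed.

Let C0 : 0 <= C.
Proof. by apply: le_trans (normr_ge0 _) (@l_lip 0 0 _); rewrite lexx ler01. Qed.

Section Grid.
Variables (v v' : R) (B : set (Omega R)) (z : nat) (b : R).
Hypotheses (v0 : 0 <= v) (vv' : v <= v') (v'1 : v' <= 1).
Hypothesis FB : filtr v B.
Hypothesis zB : forall w, B w -> Xproc v w = z.
Hypothesis lb : forall r, v <= r <= v' -> 0 <= l r z <= b.
Hypothesis hC : (v' - v) * C <= 1 / 2.

Let mB : measurable B.
Proof. by apply: filtr_measurable FB; exact: le_trans vv' v'1. Qed.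

(** On [B] the term in [X_v - z] vanishes; the factor 2 bounds the inverse of [1 - (v' - v) * C]. *)
Lemma integrable_increment : P.-integrable B (EFin \o increment v v') /\
  \int[P]_(w in B) increment v v' w <= 2 * (v' - v) * b * fine (P B).
Proof.
have X0 w : w \in B -> (Xproc v w)%:R - z%:R = 0 :> R.
  by move=> /set_mem Bw; rewrite zB // subrr.
have := mean_increment_le l_cont l_lip P_counting v0 vv' v'1 FB (lexx 0) lb.
rewrite (eq_Rintegral _ X0) Rintegral_cst // mul0r mulr0 addr0.
case=> //; first by move=> w /zB ->.
  apply: (eq_integrable mB (cst 0)) => [w Bw|]; first by rewrite /= X0.
  exact: integrable0.
move=> ii le_; split => //; move: le_.
have : 0 <= \int[P]_(w in B) increment v v' w.
  by apply: Rintegral_ge0 => w _; exact: increment_ge0.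
move: (fine (P B)) (\int[P]_(w in B) _) => p I I0 le_.
have : (v' - v) * C * I <= 1 / 2 * I by exact: ler_wpM2r.
by lra.
Qed.

Let ii := integrable_increment.1.
Let e := \int[P]_(w in B) increment v v' w.

Let e0 : 0 <= e.
Proof. by apply: Rintegral_ge0 => w _; exact: increment_ge0. Qed.

Let b0 : 0 <= b.
Proof.
have /andP[] : 0 <= l v z <= b by apply: lb; rewrite lexx vv'.
exact: le_trans.
Qed.

(** On the event [X_s > z] one has [1 <= X_s - z <= increment v v'], so both its probability in [B]
    and the mean excess there are at most [e]. Restarting the mean estimate at [s] multiplies this
    by the length [t - s]. *)
Let window_le s t : v <= s -> s <= t -> t <= v' ->
  let f := increment s t \_ [set w : Omega R | (z < Xproc s w)%N] in
  P.-integrable B (EFin \o f) /\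
  \int[P]_(w in B) f w <= 2 * (t - s) * (b + C) * e.
Proof.
move=> vs st tv' f.
have s0 : 0 <= s := le_trans v0 vs.
have t1 : t <= 1 := le_trans tv' v'1.
have s01 : 0 <= s <= 1 by rewrite s0 (le_trans st t1).
pose D := [set w : Omega R | (z < Xproc s w)%N].
have mD : measurable D by exact: (measurable_Xproc (fun n => (z < n)%N)).
have FBD : filtr s (B `&` D).
  apply: filtrI; first exact: filtr_le FB.
  exact: (filtr_Xproc (fun n => (z < n)%N)).
have mBD : measurable (B `&` D) by exact: measurableI.
have Xs w : B w -> 0 <= (Xproc s w)%:R - z%:R :> R /\ (Xproc s w)%:R - z%:R <= increment v v' w.
  move=> Bw; split; first by rewrite subr_ge0 ler_nat -(zB Bw) Xproc_le.
  rewrite /increment (zB Bw).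
  by rewrite lerD2r ler_nat Xproc_le // (le_trans st).
have iX : P.-integrable B (EFin \o (fun w => (Xproc s w)%:R - z%:R : R)).
  apply: (le_integrable mB _ _ ii).
    apply/measurable_EFinP.
    exact: (measurable_fun_Xproc (fun n => n%:R - z%:R)).
  move=> w Bw /=; rewrite lee_fin; have [x0 xi] := Xs w Bw.
  by rewrite !ger0_norm //; exact: le_trans xi.
have sub (g : Omega R -> R) : P.-integrable B (EFin \o g) ->
    P.-integrable (B `&` D) (EFin \o g).
  by apply: integrableS => // w [].
have lb' r : s <= r <= t -> 0 <= l r z <= b.
  by case/andP=> sr rt; apply: lb; rewrite (le_trans vs sr) (le_trans rt tv').
have hC' : (t - s) * C <= 1 / 2.
  by apply: le_trans hC; apply: ler_wpM2r => //; lra.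
have [|iw le_] := mean_increment_le l_cont l_lip P_counting s0 st t1 FBD
  (lexx 0) lb' _ (sub _ iX) hC'; first by move=> w [_ /ltnW].
split.
  have := (integrable_restrict P mD mB (EFin \o increment s t)).1 iw.
  apply: eq_integrable => // w _ /=; rewrite /f !patchE /=.
  by case: ifP.
rewrite -Rintegral_mkcondr.
set J := \int[P]_(w in B `&` D) ((Xproc s w)%:R - z%:R) in le_.
have Je : J <= e.
  rewrite /J Rintegral_mkcondr; apply: le_Rintegral => //.
    have := (integrable_restrict P mD mB
      (EFin \o (fun w => (Xproc s w)%:R - z%:R : R))).1 (sub _ iX).
    apply: eq_integrable => // w _ /=; rewrite !patchE /=.
    by case: ifP.
  move=> w Bw; rewrite patchE; case: ifP => _; last exact: increment_ge0.
  by case: (Xs w Bw).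
have pJ : fine (P (B `&` D)) <= J.
  rewrite -[leLHS]mul1r -(Rintegral_cst P mBD); apply: le_Rintegral => //.
  - exact: finite_measure_integrable_cst.
  - exact: sub.
  by move=> w [Bw /= zs]; rewrite -natrB ?ler1n ?subn_gt0 // ltnW.
move: le_ Je pJ hC'; rewrite -/D.
have : 0 <= \int[P]_(w in B `&` D) increment s t w.
  by apply: Rintegral_ge0 => w _; exact: increment_ge0.
move: (fine _) (\int[P]_(w in _) _) => p I I0 le_ Je pJ hC'.
have h1 : (t - s) * C * I <= 1 / 2 * I by exact: ler_wpM2r.
have h2 : b * p <= b * e by apply: ler_wpM2l => //; exact: le_trans Je.
have h3 : C * J <= C * e by exact: ler_wpM2l.
have h4 : (t - s) * (b * p + C * J) <= (t - s) * ((b + C) * e).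
  by apply: ler_wpM2l; lra.
by lra.
Qed.

(** The truncated difference counts the jumps after the first. Cut the window into [K.+1] equal
    pieces and keep the increments that start above [z]: by [window_le] their total mean has a bound
    independent of [K], and once the mesh resolves the plateau at [z.+1] they dominate the count. As
    [e] is itself of the order of the window length, the bound is quadratic. *)
Lemma double_jump_le :
  P.-integrable B (EFin \o (fun w => (Xproc v' w - z.+1)%:R : R)) /\
  \int[P]_(w in B) (Xproc v' w - z.+1)%:R <= 2 * (v' - v) * (b + C) * e.
Proof.
pose t K k : R := v + (v' - v) * (k%:R / K.+1%:R).
have h0 : 0 <= v' - v by rewrite subr_ge0.
have K0 K : 0 < K.+1%:R :> R by rewrite ltr0n.
have t_0 K : t K 0%N = v by rewrite /t mul0r mulr0 addr0.
have t_K K : t K K.+1 = v' by rewrite /t divff ?gt_eqF // mulr1 subrKC.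
have t_S K k : t K k.+1 - t K k = (v' - v) / K.+1%:R.
  rewrite /t -natr1; move: (K0 K) => /lt0r_neq0; move: (K.+1%:R) => q q0.
  by field.
have t_le K k : t K k <= t K k.+1.
  by rewrite -subr_ge0 t_S; apply: divr_ge0 => //; exact: ltW.
have t_mono K i j : (i <= j)%N -> t K i <= t K j.
  by move=> /subnK <-; elim: (j - i)%N => // n IH; exact: le_trans IH (t_le _ _).
have tv K k : v <= t K k by rewrite -{1}(t_0 K); exact: t_mono.
pose f K k := increment (t K k) (t K k.+1) \_ [set w : Omega R | (z < Xproc (t K k) w)%N].
(* Zero past the end of the grid, so that integrability holds for every natural index, as
   [Rintegral_sum] asks. *)
pose g K k := if (k < K.+1)%N then f K k else cst 0.
have gK K k : P.-integrable B (EFin \o g K k) /\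
    \int[P]_(w in B) g K k w <= 2 * ((v' - v) / K.+1%:R) * (b + C) * e.
  rewrite /g; case: ifP => [kK|_].
    by rewrite -(t_S K k); apply: window_le => //; rewrite -(t_K K); exact: t_mono.
  split; first exact: integrable0.
  rewrite Rintegral_cst // mul0r; apply: mulr_ge0 => //.
  apply: mulr_ge0; last exact: addr_ge0.
  by apply: mulr_ge0 => //; apply: divr_ge0 => //; exact: ltW.
have S_ K := Rintegral_sum K.+1 mB (fun k => (gK K k).1).
apply: (@fatou_Rintegral_le _ _ _ P B mB (fun K w => \sum_(k < K.+1) g K k w)).
- by move=> K; exact: (S_ K).1.
- move=> K w Bw; apply: sumr_ge0 => i _; rewrite /g; case: ifP => // _.
  by rewrite /f patchE; case: ifP => // _; exact: increment_ge0.
- move=> K; rewrite (S_ K).2.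
  apply: (@le_trans _ _ (\sum_(k < K.+1) 2 * ((v' - v) / K.+1%:R) * (b + C) * e)).
    by apply: ler_sum => k _; exact: (gK K k).2.
  rewrite sumr_const card_ord -[leLHS]mulr_natl.
  move: (K0 K) => /lt0r_neq0; move: (K.+1%:R) => q q0.
  by rewrite le_eqVlt; apply/orP; left; apply/eqP; field.
- apply: (measurable_fun_Xproc (fun n => (n - z.+1)%:R)) => //.
  by rewrite v'1 (le_trans v0 vv').
- by move=> w _; rewrite ler0n.
apply: aeW => w Bw.
have xmon K i : (Xproc (t K i) w <= Xproc (t K i.+1) w)%N by exact: Xproc_le.
have gE K k : (k < K.+1)%N -> g K k w = (if (z < Xproc (t K k) w)%N
    then (Xproc (t K k.+1) w)%:R - (Xproc (t K k) w)%:R else 0).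
  move=> kK; rewrite /g kK /f patchE /=; case: (ltnP z _) => zk.
    by rewrite mem_set.
  by rewrite memNset //=; apply/negP; rewrite -leqNgt.
have [le2|lt2] := leqP (Xproc v' w) z.+1.
  exists 0%N => K _; rewrite (eqP (_ : (_ - _)%N == 0)%N) ?subn_eq0 //.
  apply: sumr_ge0 => i _; rewrite gE //; case: ifP => // _.
  by rewrite subr_ge0 ler_nat.
have [r [s [vr rs sv' plat]]] := Xproc_plateau (zB Bw) lt2.
have sr0 : 0 < s - r by rewrite subr_gt0.
(* From this rank on the mesh is smaller than the plateau [[r, s[]. *)
exists (Num.bound ((v' - v) / (s - r))) => K Kb.
have hK : (v' - v) / K.+1%:R < s - r.
  rewrite ltr_pdivrMr // mulrC -ltr_pdivrMr //.
  apply: (lt_trans (archi_boundP _)); first by apply: divr_ge0 => //; exact: ltW.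
  by rewrite ltr_nat ltnS.
have ex_k : exists k, r <= t K k.
  by exists K.+1; rewrite t_K; exact: ltW (lt_le_trans rs sv').
(* The first grid time not before [r]; its predecessor is before [r], so it falls on the plateau. *)
pose k := ex_minn ex_k.
have [rk ks kK] : [/\ r <= t K k, t K k < s & (k <= K.+1)%N].
  rewrite /k; case: ex_minnP => m rm mmin; split => //; last first.
    by apply: mmin; rewrite t_K; exact: ltW (lt_le_trans rs sv').
  case: m rm mmin => [|m] rm mmin; first by rewrite t_0; exact: le_lt_trans vr rs.
  have : t K m < r.
    by rewrite ltNge; apply/negP => /mmin; rewrite ltnn.
  have := t_S K m; move: hK; move: (t K m.+1) (t K m) (_ / _) => x y q.
  by move=> h1 h2 h3; lra.
have := plat _ rk ks => Xk.
have zk : (z < Xproc (t K k) w)%N by rewrite Xk.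
have := sum_increments_above (xmon K) zk kK.
rewrite t_K Xk -natrB; last exact: ltnW.
move=> /le_trans; apply; rewrite le_eqVlt; apply/orP; left; apply/eqP.
by apply: eq_bigr => i _; rewrite gE.
Qed.

End Grid.
End DoubleJumps.

(** * Increments of the law, up to second order *)

Section ForwardEstimate.
Variables (R : realType) (l : R -> nat -> R) (C : R) (P : probability (Omega R) R).
Hypothesis l_cont : forall z, {within `[0, 1], continuous (l^~ z)}.
Hypothesis l_lip : forall t z, 0 <= t <= 1 -> `|l t z.+1 - l t z| <= C.
Hypothesis l_gt0 : forall t z, 0 <= t <= 1 -> 0 < l t z.
Hypothesis P_counting : is_counting_process l P.

(** The event [A] records the past and is kept arbitrary: this is what later stands in for the
    Markov property. *)
Definition law (A : set (Omega R)) (v : R) (z : nat) : R :=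
  fine (P (A `&` [set w | Xproc v w = z])).

(** Tails have the simplest evolution: to first order, only jumps from [z] to [z.+1] change the mass
    above [z]. *)
Definition tail_law (A : set (Omega R)) (v : R) (z : nat) : R :=
  fine (P (A `&` [set w | (z <= Xproc v w)%N])).

Let C0 : 0 <= C.
Proof. by apply: le_trans (normr_ge0 _) (@l_lip 0 0 _); rewrite lexx ler01. Qed.

Lemma tail_lawE A v z : measurable A -> 0 <= v <= 1 ->
  tail_law A v z = tail_law A v z.+1 + law A v z.
Proof.
move=> mA v01; rewrite /tail_law /law -fineD ?fin_num_measure //.
- rewrite -measureU.
  + congr (fine (P _)); rewrite -setIUr; congr setI; apply/seteqP; split => w /=.
      by rewrite leq_eqVlt => /orP[/eqP ->|]; [right|left].
    by case=> [/ltnW|->].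
  + by apply: measurableI => //; exact: (measurable_Xproc (fun n => (z < n)%N)).
  + by apply: measurableI => //; exact: (measurable_Xproc (fun n => n = z)).
  + apply/seteqP; split => // w [[_ /= zw] [_ /= wz]].
    by rewrite wz ltnn in zw.
- by apply: measurableI => //; exact: (measurable_Xproc (fun n => (z < n)%N)).
- by apply: measurableI => //; exact: (measurable_Xproc (fun n => n = z)).
Qed.

Lemma tail_law0 A v : tail_law A v 0 = fine (P A).
Proof. by rewrite /tail_law; congr (fine (P _)); apply/seteqP; split => [w []|w]. Qed.

Lemma mass_decomposition A v n : measurable A -> 0 <= v <= 1 ->
  fine (P A) = tail_law A v n + \sum_(j < n) law A v j.
Proof.
move=> mA v01; elim: n => [|n IH]; first by rewrite big_ord0 addr0 tail_law0.
by rewrite IH (tail_lawE n mA v01) big_ord_recr /= -addrA [law A v n + _]addrC.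
Qed.

Lemma law_ge0 A v z : 0 <= law A v z.
Proof. by apply: fine_ge0; exact: measure_ge0. Qed.

Lemma prob_le1 (A : set (Omega R)) : measurable A -> fine (P A) <= 1.
Proof.
by move=> mA; rewrite -lee_fin fineK ?fin_num_measure //; exact: probability_le1.
Qed.

(** The maximum of [l] at level 0 over [0,1], plus the Lipschitz growth over [z] levels. *)
Lemma intensity_bound z :
  exists L, 0 <= L /\ forall r j, 0 <= r <= 1 -> (j <= z)%N -> 0 <= l r j <= L.
Proof.
have [c c01 cmax] := EVT_max (@ler01 R) (@l_cont 0%N).
have c01' : 0 <= c <= 1 by move: c01; rewrite in_itv.
exists (l c 0%N + C * z%:R); split.
  by apply: addr_ge0; [exact/ltW/l_gt0 | exact: mulr_ge0].
move=> r j r01 jz; rewrite ltW ?l_gt0 //=.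
have := intensity_lipschitz l_lip 0 j r01.
have : l r 0%N <= l c 0%N by apply: cmax; rewrite in_itv.
have : C * j%:R <= C * z%:R by apply: ler_wpM2l => //; rewrite ler_nat.
rewrite add0n ler_norml; move: (C * _) (C * _) (l r _) (l r _) (l c _) => *.
by lra.
Qed.

(** The tail gains the paths that start at some [j <= z] and end above [z]. For [j < z] they jump
    twice; for [j = z] their probability is the mean increment up to double jumps. [K] is uniform in
    [A] and the window, and [c] is free: 0 gives a Lipschitz bound, the intensity at a point gives
    the derivative. *)
Lemma forward_estimate z : exists K, 0 <= K /\ forall A v v' c eps,
  0 <= v -> v <= v' -> v' <= 1 -> filtr v A -> (v' - v) * C <= 1 / 2 ->
  (forall r, v <= r <= v' -> `|l r z - c| <= eps) ->
  `|tail_law A v' z.+1 - tail_law A v z.+1 - (v' - v) * c * law A v z| <=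
  (v' - v) * (eps + K * (v' - v)).
Proof.
have [L [L0 lL]] := intensity_bound z.
(* The double-jump bound [2 h (L + C) e] with [e <= 2 h L], where [h] is the window length. *)
pose k := 4 * (L + C) * L.
have k0 : 0 <= k by rewrite /k !mulr_ge0 ?addr_ge0.
(* The first term pays for [h C e] in the mean estimates, the second for double jumps from the
   [z.+1] levels up to [z]. *)
exists (2 * L * C + z.+1%:R * k); split.
  by apply: addr_ge0; [rewrite !mulr_ge0|exact: mulr_ge0].
move=> A v v' c eps v0 vv' v'1 FA hC leps.
have h0 : 0 <= v' - v by rewrite subr_ge0.
have v01 : 0 <= v <= 1 by rewrite v0 (le_trans vv').
have v'01 : 0 <= v' <= 1 by rewrite v'1 (le_trans v0).
have mA : measurable A by apply: filtr_measurable FA; case/andP: v01.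
pose B j := A `&` [set w | Xproc v w = j].
have FB j : filtr v (B j).
  by apply: filtrI => //; exact: (filtr_Xproc (fun n => n = j)).
have mB j : measurable (B j) by apply: filtr_measurable (FB j); case/andP: v01.
have zB j w : B j w -> Xproc v w = j by case.
have lb j : (j <= z)%N -> forall r, v <= r <= v' -> 0 <= l r j <= L.
  move=> jz r /andP[vr rv']; apply: lL => //.
  by rewrite (le_trans v0 vr) (le_trans rv').
pose U := [set w : Omega R | (z < Xproc v' w)%N].
have mU : measurable U by exact: (measurable_Xproc (fun n => (z < n)%N)).
pose pi j := law (A `&` U) v j.
have piE j : pi j = \int[P]_(w in B j) \1_U w.
  rewrite /pi /law /Rintegral integral_indic //; congr (fine (P _)).
  by rewrite /B setIAC [U `&` _]setIC.
have split_ : tail_law A v' z.+1 = tail_law A v z.+1 + \sum_(j < z.+1) pi j.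
  have -> : tail_law A v' z.+1 = fine (P (A `&` U)) by [].
  rewrite (mass_decomposition z.+1 (measurableI _ _ mA mU) v01); congr (_ + _).
  rewrite /tail_law; congr (fine (P _)); apply/seteqP; split => w /=.
    by case=> [[]].
  by case=> Aw zw; split => //; split => //; exact: leq_trans zw (Xproc_le _ vv').
have i1 j : P.-integrable (B j) (EFin \o \1_U).
  exact: (@integrableS _ _ _ P setT (B j) _ measurableT (mB j) (@subsetT _ _)
    (integrable_indic P mU)).
have dj j (jz : (j <= z)%N) := double_jump_le l_cont l_lip P_counting
  v0 vv' v'1 (FB j) (@zB j) (lb j jz) hC.
have ij j (jz : (j <= z)%N) := integrable_increment l_cont l_lip P_counting
  v0 vv' v'1 (FB j) (@zB j) (lb j jz) hC.
have d_le j : (j <= z)%N ->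
    \int[P]_(w in B j) (Xproc v' w - j.+1)%:R <= k * (v' - v) ^+ 2.
  move=> jz; have [_ /le_trans] := dj j jz; apply.
  have [_ ] := ij j jz; move: (\int[P]_(w in _) _) => e ee.
  have pB := prob_le1 (mB j).
  have {}ee : e <= 2 * (v' - v) * L.
    apply: (le_trans ee); rewrite -[leRHS]mulr1; apply: ler_wpM2l => //.
    by rewrite !mulr_ge0.
  have : 2 * (v' - v) * (L + C) * e <= 2 * (v' - v) * (L + C) * (2 * (v' - v) * L).
    by apply: ler_wpM2l => //; have LC0 : 0 <= L + C := addr_ge0 L0 C0; rewrite !mulr_ge0.
  by move=> /le_trans; apply; rewrite le_eqVlt; apply/orP; left; apply/eqP;
    rewrite /k; ring.
have pi0 j : 0 <= pi j by exact: law_ge0.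
have pi_lt j : (j < z)%N -> pi j <= k * (v' - v) ^+ 2.
  move=> jz; apply: le_trans (d_le j (ltnW jz)); rewrite piE.
  apply: le_Rintegral => //; first exact: (dj j (ltnW jz)).1.
  move=> w Bw; rewrite indicE; case: (boolP (w \in U)) => [/set_mem /= zw|_] //.
  rewrite ler1n subn_gt0; exact: leq_trans zw.
set e := \int[P]_(w in B z) increment v v' w.
have pi_z : e - k * (v' - v) ^+ 2 <= pi z <= e.
  have [iz _] := dj z (leqnn z).
  have -> : e = pi z + \int[P]_(w in B z) (Xproc v' w - z.+1)%:R.
    rewrite piE -RintegralD //; apply: eq_Rintegral => w /set_mem Bw.
    rewrite /increment (zB _ _ Bw).
    have zX : (z <= Xproc v' w)%N by rewrite -{1}(zB _ _ Bw); exact: Xproc_le.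
    rewrite indicE; case: (boolP (w \in U)) => [/set_mem /= zw|].
      by rewrite natrB // -natr1 /=; ring.
    rewrite notin_setE /= => /negP; rewrite -leqNgt => Xz.
    have -> : Xproc v' w = z by apply/eqP; rewrite eqn_leq Xz zX.
    by rewrite subrr (eqP (_ : z - z.+1 == 0)%N) ?subn_eq0 // addr0.
  have := d_le z (leqnn z).
  have : 0 <= \int[P]_(w in B z) (Xproc v' w - z.+1)%:R :> R.
    exact: Rintegral_ge0.
  by move: (k * _) (pi z) (\int[P]_(w in _) _) => x y t; lra.
have [iz ez] := ij z (leqnn z); rewrite -/e in ez.
have e0 : 0 <= e by apply: Rintegral_ge0 => w _; exact: increment_ge0.
have p0 : 0 <= law A v z := law_ge0 _ _ _.
have p1 : law A v z <= 1 := prob_le1 (mB z).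
have ezL : e <= 2 * (v' - v) * L.
  apply: (le_trans ez); rewrite -[leRHS]mulr1; apply: ler_wpM2l => //.
  by rewrite !mulr_ge0.
(* The mean estimates ask for a nonnegative lower bound of the intensity. *)
pose a := Num.max 0 (c - eps).
have lac r : v <= r <= v' -> a <= l r z <= c + eps.
  move=> rv; have := leps r rv; have /andP[l0 _] := lb z (leqnn z) r rv.
  rewrite ler_norml /a ge_max l0 /=; move: (l r z) => x; lra.
have a0 : 0 <= a by rewrite le_max lexx.
have ace : c - eps <= a by rewrite le_max lexx orbT.
have e_up : e <= (v' - v) * (c + eps) * law A v z + (v' - v) * C * e.
  have X0 w : w \in B z -> (Xproc v w)%:R - z%:R = 0 :> R.
    by move=> /set_mem Bw; rewrite (zB _ _ Bw) subrr.
  have [w /zB -> //||] := mean_increment_le l_cont l_lip P_counting v0 vv' v'1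
    (FB z) a0 lac _ _ hC.
    apply: (eq_integrable (mB z) (cst 0)) => [w Bw|]; first by rewrite /= X0.
    exact: integrable0.
  rewrite (eq_Rintegral _ X0) Rintegral_cst // mul0r mulr0 addr0 -/e.
  rewrite -/(law A v z); move: (law A v z) => p _; lra.
have e_lo : (v' - v) * (c - eps) * law A v z - (v' - v) * C * e <= e.
  have := mean_increment_ge l_cont l_lip P_counting v0 vv' v'1
    (FB z) a0 lac (@zB z) iz.
  rewrite -/e -/(law A v z).
  have : (v' - v) * law A v z * (c - eps) <= (v' - v) * law A v z * a.
    by apply: ler_wpM2l => //; exact: mulr_ge0.
  move: (law A v z) => p; lra.
have sum_lt : 0 <= \sum_(j < z) pi j <= z%:R * (k * (v' - v) ^+ 2).
  rewrite sumr_ge0 //=; apply: (@le_trans _ _ (\sum_(j < z) k * (v' - v) ^+ 2)).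
    by apply: ler_sum => j _; exact: pi_lt.
  by rewrite sumr_const card_ord -[leLHS]mulr_natl.
rewrite split_ big_ord_recr /=.
have eps0 : 0 <= eps by apply: le_trans (normr_ge0 _) (leps v _); rewrite lexx.
have he : (v' - v) * C * e <= (v' - v) * C * (2 * (v' - v) * L).
  by apply: ler_wpM2l => //; exact: mulr_ge0.
have hep : (v' - v) * eps * law A v z <= (v' - v) * eps.
  by rewrite -[leRHS]mulr1; apply: ler_wpM2l => //; exact: mulr_ge0.
rewrite -[z.+1%:R]natr1; move: (z%:R) sum_lt pi_z e_up e_lo p0 p1 he hep h0.
move: (\sum_(_ < _) _) (tail_law A v z.+1) (law A v z) (pi z) (v' - v).
move=> S t p q h n /andP[S0 S1] /andP[q0 q1] e_up e_lo p0 p1 he hep h0.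
have -> : t + (S + q) - t - h * c * p = S + q - h * c * p by ring.
clearbody e k; clear -S0 S1 q0 q1 e_up e_lo p0 p1 he hep h0.
by rewrite ler_norml; apply/andP; split; lra.
Qed.

End ForwardEstimate.

(** * Continuity, derivatives and primitives on the line *)

Section RealLemmas.
Variable R : realType.

Lemma near_ge (a x : R) : a < x -> \forall y \near x, a <= y.
Proof. by move=> ax; apply: filterS (lt_nbhsr ax) => y /ltW. Qed.

Lemma near_le (x b : R) : x < b -> \forall y \near x, y <= b.
Proof. by move=> xb; apply: filterS (lt_nbhsl xb) => y /ltW. Qed.

Lemma locally_lipschitz_continuous (f : R -> R) a b d K : 0 < d ->
  (forall v v', a <= v -> v <= v' -> v' <= b -> v' - v <= d ->
    `|f v' - f v| <= (v' - v) * K) ->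
  {within `[a, b], continuous f}.
Proof.
move=> d0 lip; apply/subspace_continuousP => x /=; rewrite in_itv /= => /andP[ax xb].
apply/cvgrPdist_le => /= e e0.
have e'0 : 0 < e / (`|K| + 1) by rewrite divr_gt0 // ltr_wpDl.
rewrite near_withinE; near=> y; rewrite /= in_itv /= => /andP[ay yb].
have xyd : `|x - y| <= d by near: y; apply: cvgr_dist_le; [exact: cvg_id|].
have xye : `|x - y| <= e / (`|K| + 1) by near: y; apply: cvgr_dist_le; [exact: cvg_id|].
suff : `|f x - f y| <= `|x - y| * (`|K| + 1).
  by move/le_trans; apply; rewrite -ler_pdivlMr // ltr_wpDl.
have KK : K <= `|K| + 1 by rewrite (le_trans (ler_norm K)) // lerDl.
have [yx|/ltW xy] := leP y x.
  rewrite ger0_norm ?subr_ge0 // in xyd *.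
  apply: (le_trans (lip y x ay yx xb xyd)).
  by apply: ler_wpM2l => //; rewrite subr_ge0.
rewrite distrC; rewrite distrC in xyd; rewrite [X in _ <= X * _]distrC.
rewrite [X in _ <= X * _]ger0_norm ?subr_ge0 //.
rewrite ger0_norm ?subr_ge0 // in xyd.
apply: (le_trans (lip x y ax xy yb xyd)).
by apply: ler_wpM2l => //; rewrite subr_ge0.
Unshelve. all: by end_near. Qed.

(* The window [v, v'] is anchored at its left end, so the left derivative at x
   also needs the continuity of q. *)
Lemma is_derive_estimate (F q : R -> R) a b x c : a < x < b ->
  {for x, continuous q} ->
  (forall e, 0 < e -> exists2 d, 0 < d & forall v v',
    a <= v -> v <= x -> x <= v' -> v' <= b -> v' - v <= d ->
    `|F v' - F v - (v' - v) * c * q v| <= (v' - v) * e) ->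
  is_derive x 1 F (c * q x).
Proof.
move=> /andP[ax xb] cq est.
have key : (fun h => h^-1 *: (F (h *: 1 + x) - F x)) @ 0^' --> c * q x.
  apply/cvgrPdist_le => /= e e0.
  have e2 : 0 < e / 2 by rewrite divr_gt0.
  have [d d0 {}est] := est _ e2.
  have cc : {for x, continuous (fun y => c * q y)}.
    by apply: continuousM => //; exact: cvg_cst.
  have /cvgrPdist_le /(_ _ e2) qx := cc.
  have near_h (P : set R) : (\forall y \near x, P y) -> \forall h \near 0^', P (h + x).
    move=> Px; apply: nbhs_dnbhs.
    have cv : (fun h : R => h + x) @ (0 : R) --> x.
      by rewrite -[X in _ --> X]add0r; apply: cvgD; [exact: cvg_id|exact: cvg_cst].
    exact: (cv _ Px).
  near=> h.
  have h0 : h != 0 by near: h; exact: nbhs_dnbhs_neq.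
  have ah : a <= h + x by near: h; apply: (near_h (fun y => a <= y)); exact: near_ge.
  have hb : h + x <= b by near: h; apply: (near_h (fun y => y <= b)); exact: near_le.
  have hd : `|h| <= d.
    near: h; apply: nbhs_dnbhs; near=> h; rewrite -[h]subr0 distrC.
    by near: h; apply: cvgr_dist_le => //; exact: cvg_id.
  have hq : `|c * q x - c * q (h + x)| <= e / 2.
    by near: h; exact: (near_h (fun y => `|c * q x - c * q y| <= e / 2)).
  rewrite /GRing.scale /= mulr1.
  suff : `|h| * `|c * q x - h^-1 * (F (h + x) - F x)| <= `|h| * e.
    by rewrite ler_pM2l // normr_gt0.
  rewrite -normrM mulrBr [h * (h^-1 * _)]mulrA mulfV // mul1r.
  move: h0; rewrite neq_lt => /orP[hn|hp].
    have := est (h + x) x ah _ (lexx x) (ltW xb).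
    rewrite (_ : h + x <= x); last by rewrite gerDr ltW.
    have -> : x - (h + x) = - h by ring.
    move=> /(_ isT); rewrite -{1}(ltr0_norm hn) => /(_ hd).
    have : `|h * (c * q x - c * q (h + x))| <= `|h| * (e / 2).
      by rewrite normrM; apply: ler_wpM2l.
    rewrite !(ltr0_norm hn) !ler_norml.
    move: (F x) (F (h + x)) (q x) (q (h + x)) => f f' p p'.
    by move=> /andP[h1 h2] /andP[h3 h4]; apply/andP; split; lra.
  have := est x (h + x) (ltW ax) (lexx x) _ hb.
  rewrite (_ : x <= h + x); last by rewrite lerDr ltW.
  have -> : h + x - x = h by ring.
  move=> /(_ isT); rewrite -{1}(gtr0_norm hp) => /(_ hd).
  rewrite !(gtr0_norm hp) !ler_norml.
  have : 0 < h * e by exact: mulr_gt0.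
  move: (F x) (F (h + x)) (q x) => f f' p.
  by move=> he /andP[h1 h2]; apply/andP; split; lra.
by apply: DeriveDef; [apply/cvg_ex; eexists; exact: key | exact/cvg_lim].
Unshelve. all: by end_near. Qed.

(** Composition with this retraction extends a function continuous on [0,1] to one continuous on the
    whole line, with the same values on [0,1]. *)
Definition clamp (x : R) : R := Num.max 0 (Num.min 1 x).

Lemma clamp_itv x : 0 <= clamp x <= 1.
Proof. by rewrite /clamp le_max lexx /= ge_max ler01 /= ge_min lexx. Qed.

Lemma clamp_id x : 0 <= x <= 1 -> clamp x = x.
Proof.
by case/andP=> x0 x1; rewrite /clamp (min_idPr x1) (max_idPr x0).
Qed.

Lemma continuous_clamp : continuous clamp.
Proof.
move=> x; apply: continuous_max; first exact: cvg_cst.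
by apply: continuous_min; [exact: cvg_cst|exact: cvg_id].
Qed.

Lemma continuous_comp_clamp (f : R -> R) :
  {within `[0, 1], continuous f} -> continuous (f \o clamp).
Proof.
move=> /subspace_continuousP cf x.
apply: (@cvg_comp _ _ _ clamp f _ (within `[0, 1] (nbhs (clamp x)))); last first.
  by apply: cf; rewrite /= in_itv /= clamp_itv.
move=> A nA; have h : nbhs x (fun y => `[0, 1]%classic (clamp y) -> A (clamp y)).
  exact: (@continuous_clamp x _ nA).
change (nbhs x (clamp @^-1` A)); apply: filterS h => y; apply.
by rewrite /= in_itv /= clamp_itv.
Qed.

Lemma primitive_exists (f : R -> R) : continuous f ->
  exists2 F : R -> R, continuous F &
    forall x : R, 0 < x < 1 -> is_derive x 1 F (f x).
Proof.
move=> cf.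
(* Starting at -1 makes 0 an interior point; clamping [F] afterwards restores continuity on the
   whole line. *)
pose F x := \int[lebesgue_measure]_(t in `[(-1), x]) f t.
have dF (x : R) : -1 < x -> is_derive x 1 F (f x).
  move=> x1; have [] := @continuous_FTC1_closed R f (-1) x (x + 1) _ _ x1 (cf x).
  - by rewrite ltrDl.
  - apply: continuous_compact_integrable; first exact: segment_compact.
    exact: continuous_subspaceT.
  by move=> dF; rewrite derive1E => <-; exact: DeriveDef.
exists (F \o clamp).
  apply: continuous_comp_clamp; apply: derivable_within_continuous => x.
  rewrite in_itv /= => /andP[x0 _]; have [] // := dF x _.
  exact: lt_le_trans x0.
move=> x /andP[x0 x1]; apply: (@near_eq_is_derive _ _ _ F).
  near=> y; rewrite /= clamp_id //; apply/andP; split; near: y.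
    exact: near_ge.
  exact: near_le.
by apply: dF; apply: lt_trans x0.
Unshelve. all: by end_near. Qed.

End RealLemmas.

(** Inflow from the level below; level 0 receives none. *)
Definition prev (R : realType) (g : nat -> R) (z : nat) : R :=
  if z is k.+1 then g k else 0.

(** * The Kolmogorov forward equation *)

Section ForwardEquation.
Variables (R : realType) (l : R -> nat -> R) (C : R) (P : probability (Omega R) R).
Hypothesis l_cont : forall z, {within `[0, 1], continuous (l^~ z)}.
Hypothesis l_lip : forall t z, 0 <= t <= 1 -> `|l t z.+1 - l t z| <= C.
Hypothesis l_gt0 : forall t z, 0 <= t <= 1 -> 0 < l t z.
Hypothesis P_counting : is_counting_process l P.

Local Notation law := (law P).
Local Notation tail_law := (tail_law P).

Let C0 : 0 <= C.
Proof. by apply: le_trans (normr_ge0 _) (@l_lip 0 0 _); rewrite lexx ler01. Qed.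

Lemma tail_law_lipschitz z : exists K, forall A v v',
  0 <= v -> v <= v' -> v' <= 1 -> filtr v A -> (v' - v) * C <= 1 / 2 ->
  `|tail_law A v' z - tail_law A v z| <= (v' - v) * K.
Proof.
case: z => [|z].
  exists 0 => A v v' *; rewrite !tail_law0 subrr normr0 mulr0 //.
have [L [L0 lL]] := intensity_bound l_cont l_lip l_gt0 z.
have [K [K0 est]] := forward_estimate l_cont l_lip l_gt0 P_counting z.
exists (L + K) => A v v' v0 vv' v'1 FA hC.
(* With [c = 0] the whole intensity is treated as error, of size [L]. *)
have := est A v v' 0 L v0 vv' v'1 FA hC; rewrite mulr0 mul0r subr0.
move=> /(_ _)/le_trans; apply.
  move=> r /andP[vr rv']; rewrite subr0.
  have /andP[l0 lr] : 0 <= l r z <= L.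
    by apply: lL => //; rewrite (le_trans v0 vr) (le_trans rv').
  by rewrite ger0_norm.
apply: ler_wpM2l; first by rewrite subr_ge0.
by rewrite lerD2l -[leRHS]mulr1; apply: ler_wpM2l => //; lra.
Qed.

Lemma law_lipschitz z : exists K, forall A v v',
  0 <= v -> v <= v' -> v' <= 1 -> filtr v A -> (v' - v) * C <= 1 / 2 ->
  `|law A v' z - law A v z| <= (v' - v) * K.
Proof.
have [K1 lip1] := tail_law_lipschitz z.
have [K2 lip2] := tail_law_lipschitz z.+1.
exists (K1 + K2) => A v v' v0 vv' v'1 FA hC.
have v01 : 0 <= v <= 1 by rewrite v0 (le_trans vv').
have v'01 : 0 <= v' <= 1 by rewrite v'1 (le_trans v0).
have mA : measurable A by apply: filtr_measurable FA; case/andP: v01.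
have := lip1 A v v' v0 vv' v'1 FA hC; have := lip2 A v v' v0 vv' v'1 FA hC.
rewrite (tail_lawE P z mA v01) (tail_lawE P z mA v'01).
rewrite !ler_norml; move: (tail_law _ _ _) (tail_law _ _ _) (law _ _ _) (law _ _ _).
by move=> a b c d; lra.
Qed.

Let small : exists2 d : R, 0 < d & forall h, h <= d -> h * C <= 1 / 2.
Proof.
have C1 : 0 < C + 1 by exact: ltr_wpDl.
exists (1 / (2 * (C + 1))); first by rewrite divr_gt0 // mulr_gt0.
move=> h hd; apply: (le_trans (ler_wpM2r C0 hd)).
rewrite mulrAC ler_pdivrMr ?mulr_gt0 //; lra.
Qed.

Lemma law_continuous A a z : 0 <= a -> filtr a A ->
  {within `[a, 1], continuous (law A ^~ z)}.
Proof.
move=> a0 FA; have [K lip] := law_lipschitz z; have [d d0 hd] := small.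
apply: (locally_lipschitz_continuous d0 (K := K)) => v v' av vv' v'1 vd.
apply: lip => //; first exact: le_trans av.
  exact: filtr_le FA.
exact: hd.
Qed.

Lemma tail_law_derive A a x z : 0 <= a -> a < x < 1 -> filtr a A ->
  is_derive x 1 (tail_law A ^~ z.+1) (l x z * law A x z).
Proof.
move=> a0 /[dup] ax1 /andP[ax x1] FA.
apply: (@is_derive_estimate R (tail_law A ^~ z.+1) (law A ^~ z) a 1 x (l x z)) => //.
  have [+ _ _] := (continuous_within_itvP _ (lt_trans ax x1)).1
    (@law_continuous A a z a0 FA).
  by apply; rewrite in_itv /= ax x1.
move=> e e0.
have e2 : 0 < e / 2 by rewrite divr_gt0.
have [K [K0 est]] := forward_estimate l_cont l_lip l_gt0 P_counting z.
have [d d0 hd] := small.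
have cl : {for x, continuous (l^~ z)}.
  have [+ _ _] := (continuous_within_itvP _ (@ltr01 R)).1 (@l_cont z).
  by apply; rewrite in_itv /= x1 (le_lt_trans a0).
have /cvgrPdist_le /(_ _ e2) /nbhs_ballP [d1 /= d10 bl] := cl.
have K1 : 0 < K + 1 by exact: ltr_wpDl.
have d2 : 0 < e / 2 / (K + 1) by rewrite divr_gt0.
(* In turn: the window is short enough for the estimate, [l r z] stays within [e / 2] of its value
   at [x], and the second-order term costs at most [e / 2]. *)
exists (Num.min d (Num.min (d1 / 2) (e / 2 / (K + 1)))).
  by rewrite !lt_min d0 d2 divr_gt0.
move=> v v' av vx xv' v'1; rewrite !le_min => /and3P[hd_ hd1 hd2].
have vv' : v <= v' := le_trans vx xv'.
have := est A v v' (l x z) (e / 2) (le_trans a0 av) vv' v'1 (filtr_le av FA)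
  (hd _ hd_).
move=> /(_ _)/le_trans; apply.
  move=> r /andP[vr rv']; rewrite distrC; apply: bl.
  rewrite /ball /= ltr_norml; apply/andP; split; lra.
apply: ler_wpM2l; first by rewrite subr_ge0.
have : K * (v' - v) <= (K + 1) * (e / 2 / (K + 1)).
  apply: le_trans (ler_wpM2l K0 hd2) _; apply: ler_wpM2r; first exact: ltW.
  by rewrite lerDl.
by rewrite [(K + 1) * _]mulrC divfK ?gt_eqF //; lra.
Qed.

Lemma law_derive A a x z : 0 <= a -> a < x < 1 -> filtr a A ->
  is_derive x 1 (law A ^~ z)
    (prev (fun k => l x k * law A x k) z - l x z * law A x z).
Proof.
move=> a0 ax1 FA; case/andP: (ax1) => ax x1.
have mA : measurable A by apply: filtr_measurable FA; exact: ltW (lt_trans ax x1).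
have dz : is_derive x 1 (tail_law A ^~ z) (prev (fun k => l x k * law A x k) z).
  case: z => [|z] /=; last exact: (tail_law_derive z a0).
  have -> : tail_law A ^~ 0%N = cst (fine (P A)).
    by apply/funext => v; rewrite tail_law0.
  exact: is_derive_cst.
have dz1 := tail_law_derive z a0 ax1 FA.
apply: (@near_eq_is_derive _ _ _ (tail_law A ^~ z - tail_law A ^~ z.+1)).
  near=> v; rewrite [LHS](_ : _ = tail_law A v z - tail_law A v z.+1) //.
  rewrite (tail_lawE P z mA); first by rewrite addrAC subrr add0r.
  apply/andP; split; near: v; last exact: near_le.
  by apply: near_ge; exact: le_lt_trans a0 ax.
Unshelve. all: by end_near. Qed.

End ForwardEquation.

(** * Nonnegative solutions of the backward equation *)

Section BackwardEquation.
Variable R : realType.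

(** Variation of constants: [g = expR L * W] with [L' = lam] and [W' = - lam * expR (- L) * h]. On
    [0,u] [W] is nonincreasing with [W u >= 0], hence nonnegative. *)
Lemma backward_step (lam h : R -> R) (u c : R) : continuous lam -> continuous h ->
  u <= 1 -> (forall t, 0 <= lam t) ->
  (forall t, 0 <= t <= u -> 0 <= h t) -> 0 <= c ->
  exists g : R -> R, [/\ continuous g,
    forall x : R, 0 < x < 1 -> is_derive x 1 g (lam x * (g x - h x)),
    g u = c & forall t, 0 <= t <= u -> 0 <= g t].
Proof.
move=> clam ch u1 lam0 h0 c0.
have [L cL dL] := primitive_exists clam.
have cE : continuous (fun x => expR (L x)).
  by move=> x; apply: continuous_comp; [exact: cL|exact: continuous_expR].
have cEN : continuous (fun x => expR (- L x)).
  move=> x; apply: (@continuous_comp _ _ _ (fun x => - L x) expR).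
    by apply: continuousN; exact: cL.
  exact: continuous_expR.
pose f x := - (lam x * expR (- L x) * h x).
have cf : continuous f.
  move=> x; apply: cvgN; apply: cvgM; last exact: ch.
  by apply: cvgM; [exact: clam|exact: cEN].
have [W0 cW0 dW0] := primitive_exists cf.
pose W x := W0 x + (c * expR (- L u) - W0 u).
have cW : continuous W.
  by move=> x; apply: cvgD; [exact: cW0|exact: cvg_cst].
have dW (x : R) : 0 < x < 1 -> is_derive x 1 W (f x).
  by move=> x01; rewrite -[f x]addr0; apply: is_deriveD; exact: dW0.
have W_ge0 t : 0 <= t <= u -> 0 <= W t.
  case/andP=> t0 tu.
  have Wu : 0 <= W u by rewrite /W addrCA subrr addr0 mulr_ge0 ?expR_ge0.
  apply: (le_trans Wu).
  have in01 x : x \in `]t, u[ -> 0 < x < 1.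
    by rewrite in_itv /= => /andP[tx xu]; rewrite (le_lt_trans t0 tx) (lt_le_trans xu u1).
  apply: (@ler0_derive1_nincr R W t u) => //.
  - by move=> x /in01 /dW [].
  - move=> x xtu; have x01 := in01 x xtu.
    rewrite derive1E (@derive_val _ _ _ _ _ _ _ (dW x x01)) oppr_le0.
    rewrite !mulr_ge0 ?expR_ge0 // h0 //.
    move: xtu; rewrite in_itv /= => /andP[tx xu].
    by rewrite (le_trans t0 (ltW tx)) ltW.
  - exact: continuous_subspaceT.
exists (fun x => expR (L x) * W x); split.
- by move=> x; apply: cvgM; [exact: cE|exact: cW].
- move=> x x01.
  have dE : is_derive x 1 (fun x => expR (L x)) (expR (L x) * lam x).
    have := @is_derive1_comp R expR L x _ _ (is_derive_expR (L x)) (dL x x01).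
    by rewrite mulrC.
  have := is_deriveM dE (dW x x01).
  congr is_derive; rewrite /GRing.scale /= /f.
  rewrite -[X in X = _]/(_ + _).
  have eE : expR (L x) * expR (- L x) = 1 by rewrite -expRD subrr expR0.
  transitivity (- (lam x * h x * (expR (L x) * expR (- L x))) + W x * (expR (L x) * lam x)).
    by ring.
  by rewrite eE; ring.
- by rewrite /W addrCA subrr addr0 mulrCA -expRD subrr expR0 mulr1.
- by move=> t tu; rewrite mulr_ge0 ?expR_ge0 ?W_ge0.
Qed.

Lemma backward_solution (lam : nat -> R -> R) (u : R) (y : nat) :
  u <= 1 -> (forall z, continuous (lam z)) -> (forall z t, 0 <= lam z t) ->
  exists q : nat -> R -> R, forall z, [/\ continuous (q z),
    forall x : R, 0 < x < 1 -> is_derive x 1 (q z) (lam z x * (q z x - q z.+1 x)),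
    q z u = (z == y)%:R,
    forall t, 0 <= t <= u -> 0 <= q z t &
    (y < z)%N -> forall t, q z t = 0].
Proof.
move=> u1 clam lam0.
(* Descending induction on levels: [q z] depends only on [q z.+1], and zero solves the system above
   [y]. *)
suff H d : exists q : nat -> R -> R, forall z, (y.+1 - d <= z)%N ->
    [/\ continuous (q z),
    forall x : R, 0 < x < 1 -> is_derive x 1 (q z) (lam z x * (q z x - q z.+1 x)),
    q z u = (z == y)%:R,
    forall t, 0 <= t <= u -> 0 <= q z t &
    (y < z)%N -> forall t, q z t = 0].
  by have [q qP] := H y.+1; exists q => z; apply: qP; rewrite subnn.
elim: d => [|d [q qP]].
  exists (fun=> cst 0) => z; rewrite subn0 => yz; split => //.
  - by move=> x; exact: cvg_cst.
  - by move=> x _; rewrite /= subrr mulr0; exact: is_derive_cst.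
  - by rewrite gtn_eqF.
have [dy|yd] := leqP d y; last first.
  exists q => z _; apply: qP; apply: leq_trans (leq0n z).
  by rewrite leqn0 subn_eq0.
pose z0 := (y - d)%N.
have z0S : z0.+1 = (y.+1 - d)%N by rewrite subSn.
have [cq _ _ q0 _] := qP z0.+1 (eq_leq (esym z0S)).
have [g [cg dg gu g0]] := backward_step (clam z0) cq u1 (lam0 z0) q0
  (ler0n R (z0 == y)).
exists (fun z => if z == z0 then g else q z) => z; rewrite subSS -/z0 => zz0.
rewrite (gtn_eqF (_ : z0 < z.+1)%N) ?ltnS //.
case: eqP => [->|/eqP neq]; last first.
  by apply: qP; rewrite -z0S ltn_neqAle eq_sym neq.
by split => //; rewrite ltnNge leq_subr.
Qed.

End BackwardEquation.

(** * From the one-variable limit in the hypotheses to continuity and derivatives *)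

Section TimeDerivative.
Variables (R : realType) (l dl : R -> nat -> R).
Hypothesis l_diff : is_time_derivative l dl.

(** Near [t] the difference quotient is within 1 of [dl t z], whence a Lipschitz bound at [t] with
    constant [K], also at the endpoints. *)
Lemma time_derivative_continuous z : {within `[0, 1], continuous (l^~ z)}.
Proof.
apply/subspace_continuousP => t /=; rewrite in_itv /= => t01.
have /cvgrPdist_le /(_ 1 ltr01) := @l_diff z t t01; rewrite near_withinE => dlt.
apply/cvgrPdist_le => /= e e0; rewrite near_withinE.
pose K := `|dl t z| + 1.
have K0 : 0 < K by exact: ltr_wpDl.
near=> r => r01.
have rt : `|t - r| <= e / K.
  by near: r; apply: cvgr_dist_le; [exact: cvg_id|exact: divr_gt0].
have dr : (`[0, 1] `\ t) r -> `|dl t z - (l r z - l t z) / (r - t)| <= 1.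
  by near: r.
have [->|ner] := eqVneq r t; first by rewrite subrr normr0 ltW.
have h : `|dl t z - (l r z - l t z) / (r - t)| <= 1.
  by apply: dr; split => //; exact/eqP.
have {h} : `|(l r z - l t z) / (r - t)| <= K.
  rewrite -[X in `|X|](subKr (dl t z)).
  by apply: (le_trans (ler_normB _ _)); rewrite lerD2l.
have rt0 : 0 < `|r - t| by rewrite normr_gt0 subr_eq0.
rewrite normrM normfV ler_pdivrMr // distrC => /le_trans; apply.
by rewrite mulrC -ler_pdivlMr // distrC.
Unshelve. all: by end_near. Qed.

Lemma time_derivative_is_derive z (t : R) : 0 < t < 1 ->
  is_derive t 1 (l^~ z) (dl t z).
Proof.
move=> /andP[t0 t1].
have t01 : 0 <= t <= 1 by rewrite !ltW.
have key : (fun h => h^-1 *: (l (h *: 1 + t) z - l t z)) @ 0^' --> dl t z.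
  apply/cvgrPdist_le => /= e e0.
  have /cvgrPdist_le /(_ e e0) := @l_diff z t t01; rewrite near_withinE => dlt.
  have cv : (fun h : R => h + t) @ (0 : R) --> t.
    by rewrite -[X in _ --> X]add0r; apply: cvgD; [exact: cvg_id|exact: cvg_cst].
  have near_h (Q : set R) : (\forall y \near t, Q y) -> \forall h \near 0^', Q (h + t).
    by move=> Qt; apply: nbhs_dnbhs; exact: (cv _ Qt).
  have := near_h _ dlt; have := near_h _ (near_ge t0); have := near_h _ (near_le t1).
  move=> n1 n2 n3; near=> h.
  have h0 : h != 0 by near: h; exact: nbhs_dnbhs_neq.
  have ht : 0 <= h + t by near: h.
  have ht1 : h + t <= 1 by near: h.
  have : (`[0, 1] `\ t) (h + t) ->
      `|dl t z - (l (h + t) z - l t z) / (h + t - t)| <= e by near: h.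
  rewrite addrK /GRing.scale /= mulr1 [h^-1 * _]mulrC; apply; split.
    by rewrite /= in_itv /= ht.
  by move/eqP; rewrite -subr_eq0 addrK; exact/negP.
by apply: DeriveDef; [apply/cvg_ex; eexists; exact: key | exact/cvg_lim].
Unshelve. all: by end_near. Qed.

End TimeDerivative.

(** * Summation by parts over levels *)

Section Telescoping.
Variable R : realType.
Implicit Types (lam p q dlam : nat -> R) (n : nat).

(** The derivative of the truncated pairing is the flux through its upper end, which vanishes for
    [n = y.+1] because [q] is zero there. *)
Lemma sum_mass_rate lam p q n :
  \sum_(z < n) ((prev (fun k => lam k * p k) z - lam z * p z) * q z
    + p z * (lam z * (q z - q z.+1))) = - prev (fun k => lam k * p k) n * q n.
Proof.
elim: n => [|n IH]; first by rewrite big_ord0 oppr0 mul0r.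
by rewrite big_ord_recr /= IH; ring.
Qed.

Lemma sum_mean_rate lam p q n :
  \sum_(z < n) z%:R * ((prev (fun k => lam k * p k) z - lam z * p z) * q z
    + p z * (lam z * (q z - q z.+1))) =
  \sum_(z < n) lam z * p z * q z.+1
  - n%:R * (prev (fun k => lam k * p k) n * q n).
Proof.
elim: n => [|n IH]; first by rewrite !big_ord0 mul0r subr0.
by rewrite !big_ord_recr /= IH -[n.+1%:R]natr1; ring.
Qed.

(** The inflow into level [z.+1] cancels the [q z.+2] term of level [z]. What is left factors
    through the reciprocal characteristic once [lam z] is divided out. *)
Lemma sum_flow_rate lam dlam p q n : (forall z, lam z != 0) ->
  \sum_(z < n) ((dlam z * p z
      + lam z * (prev (fun k => lam k * p k) z - lam z * p z)) * q z.+1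
    + lam z * p z * (lam z.+1 * (q z.+1 - q z.+2))) =
  \sum_(z < n) lam z * p z * q z.+1 * (dlam z / lam z + (lam z.+1 - lam z))
  - lam n * prev (fun k => lam k * p k) n * q n.+1.
Proof.
move=> lam0; elim: n => [|n IH]; first by rewrite !big_ord0 mulr0 mul0r subr0.
by rewrite !big_ord_recr /= IH; field; exact: lam0.
Qed.

End Telescoping.

(** * Convexity from a nonnegative second derivative *)

Section Convexity.
Variable R : realType.
Local Open Scope convex_scope.

Lemma is_derive_bigsum n (f : nat -> R -> R) (df : nat -> R) (x : R) :
  (forall i, is_derive x 1 (f i) (df i)) ->
  is_derive x 1 (fun t => \sum_(i < n) f i t) (\sum_(i < n) df i).
Proof.
move=> fdf; have -> : (fun t => \sum_(i < n) f i t) = \sum_(i < n) f i.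
  by apply/funext => t; rewrite fct_sumE.
exact: (@is_derive_sum _ _ _ n (fun i => f i) x 1 (fun i => df i)).
Qed.

Lemma within_continuous_sum (A : set R) n (f : nat -> R -> R) :
  (forall i, {within A, continuous (f i)}) ->
  {within A, continuous (fun t => \sum_(i < n) f i t)}.
Proof.
move=> fc; elim: n => [|n IH].
  have -> : (fun t => \sum_(i < 0) f i t) = cst 0.
    by apply/funext => t; rewrite big_ord0.
  by move=> x; exact: cvg_cst.
have -> : (fun t => \sum_(i < n.+1) f i t) = (fun t => \sum_(i < n) f i t + f n t).
  by apply/funext => t; rewrite big_ord_recr.
by move=> x; apply: cvgD; [exact: IH|exact: fc].
Qed.

Lemma is_derive_mul (f g : R -> R) (x df dg : R) :
  is_derive x 1 f df -> is_derive x 1 g dg ->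
  is_derive x 1 (fun t => f t * g t) (df * g x + f x * dg).
Proof.
move=> hf hg; have := is_deriveM hf hg.
by congr is_derive; rewrite /GRing.scale /= addrC [g x * _]mulrC.
Qed.

Lemma is_derive_scale (c : R) (f : R -> R) (x df : R) :
  is_derive x 1 f df -> is_derive x 1 (fun t => c * f t) (c * df).
Proof. by move=> hf; exact: (is_deriveZ c hf). Qed.

(** [second_derivative_convex] gives the chord inequality between the two ends of an interval; it is
    applied to every [[x, y]] inside [[a, b]]. *)
Lemma second_derivative_convex_itv (f f1 f2 : R -> R) (a b : R) :
  {within `[a, b], continuous f} ->
  (forall x : R, a < x < b -> is_derive x 1 f (f1 x)) ->
  (forall x : R, a < x < b -> is_derive x 1 f1 (f2 x)) ->
  (forall x, a < x < b -> 0 <= f2 x) ->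
  convex_function (E := R^o) `[a, b] f.
Proof.
move=> cf df df1 f20 t x y; rewrite !inE /= !in_itv /= => xab yab.
wlog xy : x y t xab yab / x <= y.
  move=> H; have [xy|/ltW yx] := leP x y; first exact: H.
  by rewrite convC [leRHS]convC; exact: H.
case/andP: xab => ax xb; case/andP: yab => ay yb.
have [->|nxy] := eqVneq x y; first by rewrite !convmm.
have {nxy}xy' : x < y by rewrite lt_neqAle nxy.
have in_ab z : x < z < y -> a < z < b.
  by case/andP=> xz zy; rewrite (le_lt_trans ax xz) (lt_le_trans zy yb).
have Df z : a < z < b -> 'D_1 f z = f1 z.
  by move=> zab; exact: (@derive_val _ _ _ _ _ _ _ (df z zab)).
have dDf (z : R) : a < z < b -> is_derive z 1 ('D_1 f) (f2 z).
  move=> /[dup] zab /andP[az zb]; apply: near_eq_is_derive (df1 z zab).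
  near=> r; rewrite Df //; apply/andP; split; near: r.
    exact: lt_nbhsr.
  exact: lt_nbhsl.
have cxy : {within `[x, y], continuous f}.
  apply: continuous_subspaceW cf => r /=; rewrite !in_itv /= => /andP[xr ry].
  by rewrite (le_trans ax xr) (le_trans ry yb).
have [_ cx cy] := (continuous_within_itvP _ xy').1 cxy.
apply: (@second_derivative_convex R f x y) => //.
- move=> z /in_ab zab; rewrite (@derive_val _ _ _ _ _ _ _ (dDf z zab)).
  exact: f20.
- by move=> z; rewrite in_itv /= => /in_ab /df [].
- by move=> z; rewrite in_itv /= => /in_ab /dDf [].
Unshelve. all: by end_near. Qed.

End Convexity.

(** * The bridge mean and its two derivatives *)

Section Bridge.
Variables (R : realType) (l dl : R -> nat -> R) (C : R).
Variable P : probability (Omega R) R.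
Hypothesis l_diff : is_time_derivative l dl.
Hypothesis l_lip : forall t z, 0 <= t <= 1 -> `|l t z.+1 - l t z| <= C.
Hypothesis l_gt0 : forall t z, 0 <= t <= 1 -> 0 < l t z.
Hypothesis P_counting : is_counting_process l P.
Variables (s u : R) (x y : nat).
Hypotheses (s0 : 0 <= s) (su : s <= u) (u1 : u <= 1).

Local Notation law := (law P).
Let l_cont := time_derivative_continuous l_diff.

Variable q : nat -> R -> R.
Hypothesis q_cont : forall z, continuous (q z).
Hypothesis q_derive : forall z (t : R), 0 < t < 1 ->
  is_derive t 1 (q z) (l t z * (q z t - q z.+1 t)).
Hypothesis q_end : forall z, q z u = (z == y)%:R.
Hypothesis q_ge0 : forall z t, 0 <= t <= u -> 0 <= q z t.
Hypothesis q_above : forall z t, (y < z)%N -> q z t = 0.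

Lemma law_continuous_upto A t z : 0 <= t -> filtr t A ->
  {within `[t, u], continuous (law A ^~ z)}.
Proof.
move=> t0 FA; have := law_continuous l_cont l_lip l_gt0 P_counting (z := z) t0 FA.
apply: continuous_subspaceW => a /=.
by rewrite !in_itv /= => /andP[-> /le_trans]; apply.
Qed.

(** By the terminal values of [q], the left side is [P (A, X_u = y)]. Validity for every event [A]
    of time [t] is what makes the bridge law computable. *)
Lemma pairing_conserved A t : s <= t -> t <= u -> filtr t A ->
  \sum_(z < y.+1) law A u z * q z u = \sum_(z < y.+1) law A t z * q z t.
Proof.
move=> st tu FA.
have t0 : 0 <= t := le_trans s0 st.
pose f r := \sum_(z < y.+1) law A r z * q z r.
have df (r : R) : r \in `]t, u[ -> is_derive r 1 f 0.
  rewrite in_itv /= => /andP[tr ru].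
  have r1 : r < 1 := lt_le_trans ru u1.
  have dp z := law_derive l_cont l_lip l_gt0 P_counting z t0
    (introT andP (conj tr r1)) FA.
  have dq z := q_derive z (introT andP (conj (le_lt_trans t0 tr) r1)).
  have := is_derive_bigsum y.+1 (fun z => is_derive_mul (dp z) (dq z)).
  by rewrite (sum_mass_rate (l r) (law A r) (q^~ r)) q_above // mulr0.
have cf : {within `[t, u], continuous f}.
  apply: (within_continuous_sum (f := fun z r => law A r z * q z r)) => z r.
  apply: cvgM; last exact: (continuous_subspaceT (@q_cont z)).
  exact: (law_continuous_upto (z := z) t0 FA).
have [c _] := MVT_segment tu df cf.
by rewrite mul0r => /eqP; rewrite subr_eq0 => /eqP.
Qed.

Let A0 := [set w : Omega R | Xproc s w = x].

Let FA0 t : s <= t -> filtr t A0.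
Proof. by move=> st; exact: (filtr_Xproc (fun n => n = x)). Qed.

(** Conservation for the event [X_s = x, X_t = z]: at time [u] only the term [y] survives, at time
    [t] only the term [z]. *)
Lemma bridge_law t z : s <= t -> t <= u -> (z <= y)%N ->
  law (A0 `&` [set w | Xproc t w = z]) u y = law A0 t z * q z t.
Proof.
move=> st tu zy.
have t0 : 0 <= t := le_trans s0 st.
have FA : filtr t (A0 `&` [set w | Xproc t w = z]).
  by apply: filtrI; [exact: FA0 | exact: (filtr_Xproc (fun n => n = z))].
have := pairing_conserved st tu FA.
rewrite (bigD1 (Ordinal (ltnSn y))) //= q_end eqxx mulr1.
rewrite big1 ?addr0; last first.
  by move=> k ky; rewrite q_end (_ : (k : nat) == y = false) ?mulr0 //;
    apply/negbTE; apply: contra ky => /eqP ky; apply/eqP/val_inj.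
move=> ->; rewrite (bigD1 (Ordinal (zy : z < y.+1)%N)) //= big1 ?addr0.
  by rewrite /law -setIA setIid.
move=> k kz; rewrite (_ : law _ t k = 0) ?mul0r //.
rewrite /law (_ : _ `&` _ = set0) ?measure0 //; apply/seteqP; split => // w.
move=> [[_ /= wz] wk]; move/eqP: kz; apply; apply/val_inj => /=.
by rewrite -wz.
Qed.

Definition weighted_mean t : R := \sum_(z < y.+1) z%:R * (law A0 t z * q z t).

Lemma bridge_meanE t : s <= t -> t <= u ->
  bridge_mean P s u x y t = weighted_mean t / fine (P (bridge_event s u x y)).
Proof.
move=> st tu; rewrite /bridge_mean; congr (_ / _).
have t01 : 0 <= t <= 1 by rewrite (le_trans s0 st) (le_trans tu u1).
have u01 : 0 <= u <= 1 by rewrite u1 (le_trans s0 su).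
have s01 : 0 <= s <= 1 by rewrite s0 (le_trans su u1).
set E := bridge_event s u x y.
have mE : measurable E.
  apply: (@measurableI _ _ A0 [set w | Xproc u w = y]).
    exact: (measurable_Xproc (fun n => n = x)).
  exact: (measurable_Xproc (fun n => n = y)).
pose L z := [set w : Omega R | Xproc t w = z].
have mL z : measurable (L z) by exact: (measurable_Xproc (fun n => n = z)).
have iL z : P.-integrable E (EFin \o \1_(L z)).
  exact: (@integrableS _ _ _ P setT E _ measurableT mE (@subsetT _ _)
    (integrable_indic P (mL z))).
have iL' z : P.-integrable E (EFin \o (fun w => z%:R * \1_(L z) w)).
  exact: (integrableZl mE _ (iL z)).
(* On the bridge event [X_t <= X_u = y], so the levels up to [y] suffice. *)
transitivity (\int[P]_(w in E) \sum_(z < y.+1) z%:R * \1_(L z) w).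
  apply: (@eq_Rintegral _ _ _ P E (fun w => \sum_(z < y.+1) z%:R * \1_(L z) w)
    (fun w => (Xproc t w)%:R)) => w /set_mem [_ /= wy].
  have wy' : (Xproc t w < y.+1)%N by rewrite ltnS -wy; exact: Xproc_le.
  rewrite (bigD1 (Ordinal wy')) //= big1 ?addr0.
    by rewrite indicE mem_set // mulr1.
  move=> k kw; rewrite indicE memNset ?mulr0 //= => h; move/eqP: kw; apply.
  exact/val_inj.
rewrite (@Rintegral_sum R _ _ P E (fun z w => z%:R * \1_(L z) w) y.+1 mE iL').2.
apply: eq_bigr => z _; rewrite RintegralZl //; congr (_ * _).
transitivity (law (A0 `&` L z) u y); last first.
  by apply: bridge_law => //; rewrite -ltnS.
rewrite /Rintegral (integral_indic P mE (mL z)); congr (fine _).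
change (P (L z `&` E) = P (A0 `&` L z `&` [set w | Xproc u w = y])).
congr (P _); apply/seteqP; split => w /=.
  by case=> wz [ws wu].
by case=> [[ws wz] wu].
Qed.

Lemma weighted_mean_derive (t : R) : s < t < u ->
  is_derive t 1 weighted_mean (\sum_(z < y.+1) l t z * law A0 t z * q z.+1 t).
Proof.
move=> /andP[st tu]; have t1 := lt_le_trans tu u1.
have dp z := law_derive l_cont l_lip l_gt0 P_counting z s0
  (introT andP (conj st t1)) (FA0 (lexx s)).
have dq z := q_derive z (introT andP (conj (le_lt_trans s0 st) t1)).
have := is_derive_bigsum y.+1
  (fun z => is_derive_scale z%:R (is_derive_mul (dp z) (dq z))).
by rewrite (sum_mean_rate (l t) (law A0 t) (q^~ t)) q_above // !mulr0 subr0.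
Qed.

Lemma weighted_mean_derive2 (t : R) : s < t < u ->
  is_derive t 1 (fun t => \sum_(z < y.+1) l t z * law A0 t z * q z.+1 t)
    (\sum_(z < y.+1) l t z * law A0 t z * q z.+1 t * Xi l dl t z).
Proof.
move=> /andP[st tu]; have t1 := lt_le_trans tu u1.
have t01 : 0 < t < 1 by rewrite t1 (le_lt_trans s0).
have l0 z : l t z != 0.
  by rewrite gt_eqF // l_gt0 //; case/andP: t01 => /ltW -> /ltW ->.
have dp z := law_derive l_cont l_lip l_gt0 P_counting z s0
  (introT andP (conj st t1)) (FA0 (lexx s)).
have dlt z := time_derivative_is_derive l_diff z t01.
have := is_derive_bigsum y.+1
  (fun z => is_derive_mul (is_derive_mul (dlt z) (dp z)) (q_derive z.+1 t01)).
rewrite (sum_flow_rate (dl t) (law A0 t) (q^~ t) y.+1 l0) q_above //.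
rewrite mulr0 subr0; congr is_derive; apply: eq_bigr => z _.
by rewrite /Xi l0.
Qed.

Lemma convex_bridge_mean (c : R) :
  (forall t z, 0 <= t <= 1 -> 0 <= c * Xi l dl t z) ->
  convex_function (E := R^o) `[s, u] (fun t => c * bridge_mean P s u x y t).
Proof.
move=> cXi.
(* An event of probability zero gives [K = 0], in agreement with the value 0 of [bridge_mean]
   there. *)
pose K := c / fine (P (bridge_event s u x y)).
pose m1 t := K * \sum_(z < y.+1) l t z * law A0 t z * q z.+1 t.
pose m2 t := K * \sum_(z < y.+1) l t z * law A0 t z * q z.+1 t * Xi l dl t z.
have cvxm : convex_function (E := R^o) `[s, u] (fun t => K * weighted_mean t).
  apply: (@second_derivative_convex_itv R _ m1 m2).
  - move=> r; apply: cvgM; first exact: cvg_cst.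
    apply: (within_continuous_sum
      (f := fun z r => z%:R * (law A0 r z * q z r))) => z {}r.
    apply: cvgM; first exact: cvg_cst.
    apply: cvgM; last exact: (continuous_subspaceT (@q_cont z)).
    exact: (law_continuous_upto (z := z) s0 (FA0 (lexx s))).
  - by move=> t tsu; exact: is_derive_scale (weighted_mean_derive tsu).
  - by move=> t tsu; exact: is_derive_scale (weighted_mean_derive2 tsu).
  - move=> t /andP[st tu].
    have t01 : 0 <= t <= 1.
      by rewrite (le_trans s0 (ltW st)) (le_trans (ltW tu) u1).
    rewrite /m2 mulr_sumr; apply: sumr_ge0 => z _.
    have -> : K * (l t z * law A0 t z * q z.+1 t * Xi l dl t z) =
      (fine (P (bridge_event s u x y)))^-1 *
      (l t z * law A0 t z * q z.+1 t) * (c * Xi l dl t z) by rewrite /K; ring.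
    apply: mulr_ge0; last exact: cXi.
    rewrite mulr_ge0 ?invr_ge0 ?fine_ge0 ?measure_ge0 //.
    rewrite !mulr_ge0 ?law_ge0 //; first exact/ltW/l_gt0.
    by apply: q_ge0; rewrite (le_trans s0 (ltW st)) (ltW tu).
have E t : s <= t <= u -> c * bridge_mean P s u x y t = K * weighted_mean t.
  by case/andP=> st tu; rewrite bridge_meanE // /K; ring.
move=> t a b; rewrite !inE => ha hb.
have := cvxm t a b; rewrite !inE => /(_ ha hb).
move: ha hb; rewrite /= !in_itv /= => ha hb; rewrite !E //.
(* The identity [E] holds only on [[s, u]], so the intermediate point must be located before
   rewriting. *)
have between (r : {i01 R}) (p p' : R^o) : p <= p' -> s <= p -> p' <= u ->
    s <= conv r p p' <= u.
  move=> pp' sp p'u; have := convR_itv r pp'; rewrite in_itv /= => /andP[h1 h2].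
  by rewrite (le_trans sp h1) (le_trans h2 p'u).
case/andP: ha hb => sa au /andP[sb bu].
have [ab|/ltW ba] := leP a b; first exact: between.
by rewrite convC; exact: between.
Qed.

End Bridge.

Unset Implicit Arguments.

Theorem theorem2p1 (R : realType) (l dl : R -> nat -> R)
  (P : probability (Omega R) R) :
  is_counting_process l P ->
  standing_assumptions l dl ->
  (forall n : nat, (0 < P [set w | Xproc 0 w = n])%E) ->
  ((forall t z, 0 <= t <= 1 -> 0 <= Xi l dl t z) ->
     forall s u : R, 0 <= s -> s <= u -> u <= 1 ->
     forall x y : nat, (x <= y)%N ->
       convex_function (E := R^o) `[s, u] (bridge_mean P s u x y))
  /\
  ((forall t z, 0 <= t <= 1 -> Xi l dl t z <= 0) ->
     forall s u : R, 0 <= s -> s <= u -> u <= 1 ->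
     forall x y : nat, (x <= y)%N ->
       convex_function (E := R^o) `[s, u] (fun t => - bridge_mean P s u x y t)).
Proof.
move=> P_counting [[l_diff _] [C l_lip] l_gt0] _.
(* Both halves at once: [c] is 1 for convexity and -1 for concavity. *)
have cvx s u x y c : 0 <= s -> s <= u -> u <= 1 ->
    (forall t z, 0 <= t <= 1 -> 0 <= c * Xi l dl t z) ->
    convex_function (E := R^o) `[s, u] (fun t => c * bridge_mean P s u x y t).
  move=> s0 su u1 cXi.
  (* Nothing is known of [l] outside [0,1]; clamping time makes the rates continuous and positive on
     the whole line. *)
  have [q qP] := @backward_solution R (fun z t => l (clamp t) z) u y u1
    (fun z => continuous_comp_clamp (time_derivative_continuous l_diff (z := z)))
    (fun z t => ltW (l_gt0 _ z (clamp_itv t))).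
  apply: (@convex_bridge_mean R l dl C P l_diff l_lip l_gt0 P_counting
    s u x y s0 su u1 q) => //.
  - by move=> z; have [] := qP z.
  - move=> z t /[dup] t01 /andP[/ltW t0 /ltW t1]; have [_ + _ _ _] := qP z.
    by move=> /(_ t t01); rewrite clamp_id // t0.
  - by move=> z; have [] := qP z.
  - by move=> z; have [] := qP z.
  - by move=> z t yz; have [_ _ _ _ /(_ yz)] := qP z.
split=> HXi s u s0 su u1 x y _.
  have := cvx s u x y 1 s0 su u1.
  have -> : (fun t => 1 * bridge_mean P s u x y t) = bridge_mean P s u x y.
    by apply/funext => t; rewrite mul1r.
  by apply=> t z t01; rewrite mul1r; exact: HXi.
have := cvx s u x y (-1) s0 su u1.
have -> : (fun t => -1 * bridge_mean P s u x y t) =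
    (fun t => - bridge_mean P s u x y t).
  by apply/funext => t; rewrite mulN1r.
by apply=> t z t01; rewrite mulN1r oppr_ge0; exact: HXi.
Qed.
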